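(* Let $n\ge 3$, $-2<l_2<l_1\le 0$, $\frac{n+l_1}{n-2}<p<q$, and let $u$ be a positive radial solution of $$\Delta u+|x|^{l_1}u^{p}+|x|^{l_2}u^{q}=0 .$$ Put $v_1(r)=r^{\alpha_1}u(r)$ and $v_2(r)=r^{\alpha_2}u(r)$. (i) If $q=\frac{n+2+2l_2}{n-2}$, then either [$\lim_{r\to0}r^{\alpha_2}u(r)=\lambda_2$ or $\lim_{r\to0}u(r)=c_2$ for some constant $c_2>0$], or $v_2(r)$ oscillates endlessly near the origin between two sequences $(\mu_{1,i})$ and $(\mu_{2,i})$ satisfying $0<\mu_{1,i}<\mu_{2,i}$ and $$\lim_{i\to\infty}\mu_{1,i}=\mu_1,\qquad \lim_{i\to\infty}\mu_{2,i}=\mu_2,$$ $$\mu_1=\liminf_{r\to0}r^{\frac{n-2}{2}}u(r)<\limsup_{r\to0}r^{\frac{n-2}{2}}u(r)=\mu_2,$$ where $\mu_1,\mu_2$ satisfy $$0<\mu_1\le\lambda_2\le\mu_2,\qquad b(\mu_1)=b(\mu_2)<0,\qquad b(v)=\frac{1}{q+1}v^{q+1}-\frac{\lambda_2^{q-1}}{2}v^2 .$$ (ii) If $p=\frac{n+2+2l_1}{n-2}$, then either [$\lim_{r\to\infty}r^{\alpha_1}u(r)=\lambda_1$ or $\lim_{r\to\infty}r^{n-2}u(r)=c_1$ for some constant $c_1>0$], or $v_1(r)$ oscillates endlessly near $\infty$ between two sequences $(\mu'_{1,i})$ and $(\mu'_{2,i})$ satisfying $0<\mu'_{1,i}<\mu'_{2,i}$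 and $$\lim_{i\to\infty}\mu'_{1,i}=\mu'_1,\qquad \lim_{i\to\infty}\mu'_{2,i}=\mu'_2,$$ $$\mu'_1=\liminf_{r\to\infty}r^{\frac{n-2}{2}}u(r)<\limsup_{r\to\infty}r^{\frac{n-2}{2}}u(r)=\mu'_2,$$ where $\mu'_1,\mu'_2$ satisfy $$0<\mu'_1\le\lambda_1\le\mu'_2,\qquad b_1(\mu'_1)=b_1(\mu'_2),\qquad b_1(v)=\frac{1}{p+1}v^{p+1}-\frac{\lambda_1^{p-1}}{2}v^2 .$$
   Context: A positive radial solution is a function $u=u(r)$, $r=|x|$, that is $C^2$ and positive on $(0,\infty)$ and satisfies $u''+\frac{n-1}{r}u'+r^{l_1}u^p+r^{l_2}u^q=0$ for all $r\in(0,\infty)$ (so $u$ may be singular at the origin). Notation: $\alpha_1=\frac{2+l_1}{p-1}$, $\alpha_2=\frac{2+l_2}{q-1}$; $\lambda_1>0$ and $\lambda_2>0$ are defined by $\lambda_1^{p-1}=\alpha_1(n-2-\alpha_1)$ and $\lambda_2^{q-1}=\alpha_2(n-2-\alpha_2)$. In case (i) $\alpha_2=\frac{n-2}{2}$, and in case (ii) $\alpha_1=\frac{n-2}{2}$. ''$v$ oscillates endlessly near the origin (resp. near $\infty$) between the sequences $(m_{1,i})$ and $(m_{2,i})$'' means that there are sequences of points $\eta_i$ and $\varepsilon_i$, both tending to $0$ (resp. to $\infty$) as $i\to\infty$, such that $\eta_i$ are local minima of $v$ with $v(\eta_i)=m_{1,i}$ and $\varepsilon_i$ are local maxima of $v$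 with $v(\varepsilon_i)=m_{2,i}$. *)

(* Defs.v *)
From Stdlib Require Import Reals.
From Coquelicot Require Import Coquelicot.

Open Scope R_scope.

(** Real powers are written [Rpower x y = exp (y * ln x)]; every base that
    matters below is positive. Functions of the radius have type [R -> R], and
    their values at [r <= 0] are irrelevant. *)

Definition positive_radial_solution (n : nat) (l1 l2 p q : R) (u : R -> R) : Prop :=
  forall r : R, 0 < r ->
    0 < u r /\
    ex_derive u r /\
    ex_derive (Derive u) r /\
    continuous (Derive (Derive u)) r /\
    Derive (Derive u) r + (INR n - 1) / r * Derive u r
      + Rpower r l1 * Rpower (u r) p + Rpower r l2 * Rpower (u r) q = 0.

Definition alpha (l s : R) : R := (2 + l) / (s - 1).

Definition potential (s lam v : R) : R :=
  1 / (s + 1) * Rpower v (s + 1) - Rpower lam (s - 1) / 2 * v ^ 2.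

Definition Inf_on (P : R -> Prop) (f : R -> R) : Rbar :=
  Glb_Rbar (fun y => exists x : R, P x /\ y = f x).

Definition Sup_on (P : R -> Prop) (f : R -> R) : Rbar :=
  Lub_Rbar (fun y => exists x : R, P x /\ y = f x).

(** Extended-real lower and upper limits along a filter: the supremum of the
    infima, and the infimum of the suprema, over the sets of the filter. *)
Definition LimInf (F : (R -> Prop) -> Prop) (f : R -> R) : Rbar :=
  Rbar_lub (fun m => exists P : R -> Prop, F P /\ m = Inf_on P f).

Definition LimSup (F : (R -> Prop) -> Prop) (f : R -> R) : Rbar :=
  Rbar_glb (fun m => exists P : R -> Prop, F P /\ m = Sup_on P f).

Definition is_local_min (f : R -> R) (x : R) : Prop :=
  locally x (fun y => f x <= f y).

Definition is_local_max (f : R -> R) (x : R) : Prop :=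
  locally x (fun y => f y <= f x).

(** The filter [F] is [at_right 0] (near the origin) or
    [Rbar_locally p_infty] (near infinity). *)
Definition oscillates_endlessly (F : (R -> Prop) -> Prop) (v : R -> R)
    (m1 m2 : nat -> R) : Prop :=
  exists eta eps : nat -> R,
    filterlim eta eventually F /\
    filterlim eps eventually F /\
    forall i : nat,
      0 < eta i /\ is_local_min v (eta i) /\ v (eta i) = m1 i /\
      0 < eps i /\ is_local_max v (eps i) /\ v (eps i) = m2 i.

(* Main.v *)
Require Import Defs.
From Stdlib Require Import Reals Ranalysis5 Lra Lia IndefiniteDescription Classical.
From Coquelicot Require Import Coquelicot.

(** Both parts are one statement about a scalar equation in logarithmic time.
    Let [m = (n - 2) / 2], the decay rate attached to a critical exponent, and
    put [r = exp (k t)] with [k = -1] near the origin and [k = 1] near infinity,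
    so that [t] tends to infinity in both cases. Then [v t = r ^ m * u r] solves
      [v'' = v * (lam ^ (a - 1) - v ^ (a - 1) - exp (- sigma t) * v ^ (b - 1))],
    where [a] is the critical exponent, [b] the other one, [lam ^ (a - 1) = m ^ 2],
    and [sigma > 0] because [l2 < l1] and [p < q] ([radial_solution_orbit]).
    This is a Hamiltonian equation with potential energy [potential a lam],
    perturbed by a term that decays in time.

    The full energy, perturbing term included, has a negative time derivative,
    so it decreases. It controls the growing function [potential a lam v], hence
    [v] is bounded on the future half-line without any a priori estimate; the
    perturbing term therefore vanishes in the limit, and
    [v' ^ 2 / 2 + potential a lam v] converges to a number [e].

    If [v] is eventually monotone it converges. A positive limit must be the
    equilibrium [lam] ([positive_limit_eq_lam]). If the limit is [0], then [e = 0]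
    and the energy, which decreases to [0], is positive. In this form it says
    that the logarithmic slope of [v] differs from [- m] by an integrable
    quantity, so [exp (m t) * v t] has a positive limit ([fast_decay]).

    If [v] is not eventually monotone, it has arbitrarily late local minima and
    maxima. At a late local minimum the energy is negative
    ([eventually_local_min_energy_neg]), hence [e < 0]. Either [e] is the minimum of
    the potential and [v] tends to [lam], or [e] is the value of the potential at
    exactly two points [mu1 < lam < mu2]. The potential energy never exceeds the
    total energy, so [v] is confined to [[mu1, mu2]] in the limit; at extrema the
    two agree, so local minima approach [mu1] and local maxima approach [mu2].
    [orbit_trichotomy] collects these three cases and [critical_alternative]
    carries them back to the radius. *)

Open Scope R_scope.

(** * Limits at infinity *)

Lemma nondecreasing_of_derive (f g : R -> R) (T : R) :
  (forall x, T <= x -> is_derive f x (g x)) -> (forall x, T <= x -> 0 <= g x) ->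
  forall x y, T <= x <= y -> f x <= f y.
Proof.
  intros Hd Hg x y [Hx [Hxy | ->]]; [| lra].
  destruct (MVT_cor2 f g x y Hxy) as [c [Hc Hcxy]].
  - intros c Hc. apply is_derive_Reals, Hd. lra.
  - assert (0 <= g c * (y - x)) by (apply Rmult_le_pos; [apply Hg |]; lra). lra.
Qed.

Lemma eventually_and (P Q : R -> Prop) :
  Rbar_locally p_infty P -> Rbar_locally p_infty Q ->
  Rbar_locally p_infty (fun t => P t /\ Q t).
Proof. apply (filter_and (F := Rbar_locally p_infty)). Qed.

Lemma is_lim_nondecreasing (f : R -> R) (T M : R) :
  (forall x y, T <= x <= y -> f x <= f y) -> (forall x, T <= x -> f x <= M) ->
  exists l : R, is_lim f p_infty l /\ forall x, T <= x -> f x <= l.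
Proof.
  intros Hf HM.
  destruct (completeness (fun y => exists x, T <= x /\ y = f x)) as [l [Hub Hl]].
  - exists M. intros y [x [Hx ->]]. now apply HM.
  - exists (f T), T. split; [lra | easy].
  - exists l. split.
    + apply is_lim_spec. intros eps. simpl.
      destruct (classic (exists x, T <= x /\ l - eps < f x)) as [[x0 [Hx0 Hfx0]] | Hn].
      * exists x0. intros x Hx. assert (f x0 <= f x) by (apply Hf; lra).
        assert (f x <= l) by (apply Hub; exists x; split; [lra | easy]).
        pose proof (cond_pos eps). apply Rabs_def1; lra.
      * exfalso. assert (l <= l - eps).
        { apply Hl. intros y [x [Hx ->]]. apply Rnot_lt_le. intros Hlt. apply Hn. now exists x. }
        pose proof (cond_pos eps). lra.
    + intros x Hx. apply Hub. now exists x.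
Qed.

Lemma is_lim_nonincreasing (f : R -> R) (T M : R) :
  (forall x y, T <= x <= y -> f y <= f x) -> (forall x, T <= x -> M <= f x) ->
  exists l : R, is_lim f p_infty l /\ forall x, T <= x -> l <= f x.
Proof.
  intros Hf HM.
  destruct (is_lim_nondecreasing (fun x => - f x) T (- M)) as [l [Hl Hfl]].
  - intros x y Hxy. apply Ropp_le_contravar. now apply Hf.
  - intros x Hx. apply Ropp_le_contravar. now apply HM.
  - exists (- l). split.
    + apply (is_lim_ext (fun x => - (- f x))); [intros; ring |].
      now apply (is_lim_opp _ _ (Finite l)).
    + intros x Hx. specialize (Hfl x Hx). lra.
Qed.

Lemma is_lim_eventually (f : R -> R) (l e : R) :
  is_lim f p_infty l -> 0 < e -> Rbar_locally p_infty (fun t => l - e < f t < l + e).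
Proof.
  intros Hf He. apply is_lim_spec in Hf. destruct (Hf (mkposreal e He)) as [T HT].
  exists T. intros t Ht. specialize (HT t Ht). simpl in HT. apply Rabs_def2 in HT. lra.
Qed.

Lemma is_lim_of_eventually (f : R -> R) (l : R) :
  (forall e, 0 < e -> Rbar_locally p_infty (fun t => l - e < f t < l + e)) ->
  is_lim f p_infty l.
Proof.
  intros Hf. apply is_lim_spec. intros eps. simpl.
  destruct (Hf eps (cond_pos eps)) as [T HT].
  exists T. intros t Ht. specialize (HT t Ht). apply Rabs_def1; lra.
Qed.

Lemma is_lim_eventually_lt (f : R -> R) (l x : R) :
  is_lim f p_infty l -> l < x -> Rbar_locally p_infty (fun t => f t < x).
Proof.
  intros Hf Hx. apply (filter_imp (fun t => l - (x - l) < f t < l + (x - l))).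
  - intros t Ht. lra.
  - apply is_lim_eventually; [easy | lra].
Qed.

Lemma is_lim_eventually_gt (f : R -> R) (l x : R) :
  is_lim f p_infty l -> x < l -> Rbar_locally p_infty (fun t => x < f t).
Proof.
  intros Hf Hx. apply (filter_imp (fun t => l - (l - x) < f t < l + (l - x))).
  - intros t Ht. lra.
  - apply is_lim_eventually; [easy | lra].
Qed.

Lemma is_lim_ge_cst (f : R -> R) (l x : R) :
  is_lim f p_infty l -> (forall t, x <= f t) -> x <= l.
Proof.
  intros Hf Hx. apply Rnot_lt_le. intros Hlt.
  destruct (is_lim_eventually_lt f l x Hf Hlt) as [T HT].
  specialize (HT (T + 1)). specialize (Hx (T + 1)). lra.
Qed.

Lemma is_lim_comp_continuity_pt (f g : R -> R) (l : R) :
  is_lim g p_infty l -> continuity_pt f l -> is_lim (fun t => f (g t)) p_infty (f l).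
Proof.
  intros Hg Hf. apply continuity_pt_filterlim in Hf.
  exact (filterlim_comp _ _ _ g f _ _ _ Hg Hf).
Qed.

(** A limit of [f] forces [f (t + 1) - f t] to [0], which is a value of the
    derivative; only the square of the derivative is assumed to converge,
    because energy conservation gives no more. *)
Lemma is_lim_derive_sq_eq_0 (f g : R -> R) (A l : R) :
  (forall x, is_derive f x (g x)) -> is_lim f p_infty A ->
  is_lim (fun t => g t ^ 2) p_infty l -> l = 0.
Proof.
  intros Hd Hf Hg.
  assert (Hl : 0 <= l) by (apply (is_lim_ge_cst _ _ _ Hg); intros t; apply pow2_ge_0).
  destruct Hl as [Hl | Hl]; [exfalso | easy].
  set (c := sqrt (l / 2)).
  assert (Hc : 0 < c) by (apply sqrt_lt_R0; lra).
  assert (Hc2 : c ^ 2 = l / 2) by (unfold c; simpl; rewrite Rmult_1_r; apply sqrt_sqrt; lra).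
  destruct (eventually_and _ _ (is_lim_eventually f A (c / 2) Hf ltac:(lra))
              (is_lim_eventually_gt _ l (l / 2) Hg ltac:(lra))) as [T HT].
  destruct (MVT_cor2 f g (T + 1) (T + 2)) as [x [Hx Hx12]]; [lra | |].
  { intros. now apply is_derive_Reals. }
  destruct (HT (T + 1)) as [H1 _]; [lra |].
  destruct (HT (T + 2)) as [H2 _]; [lra |].
  destruct (HT x) as [_ H3]; [lra |].
  nra.
Qed.

Lemma is_lim_0_of_sq (g : R -> R) :
  is_lim (fun t => g t ^ 2) p_infty 0 -> is_lim g p_infty 0.
Proof.
  intros Hg. apply is_lim_of_eventually. intros e He.
  apply (filter_imp (fun t => g t ^ 2 < e ^ 2)).
  - intros t Ht. nra.
  - apply (is_lim_eventually_lt _ 0); [easy | nra].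
Qed.

Lemma filterlim_nat_p_infty (x : nat -> R) :
  (forall i, INR i < x i) -> filterlim x eventually (Rbar_locally p_infty).
Proof.
  intros Hx P [M HM]. destruct (nfloor_ex (Rmax 0 M)) as [N [_ HN]]; [apply Rmax_l |].
  exists (S N). intros i Hi. apply HM.
  apply le_INR in Hi. rewrite S_INR in Hi. specialize (Hx i).
  pose proof (Rmax_r 0 M). lra.
Qed.

Lemma exists_convergent_values (f : R -> R) (Q : R -> Prop) (mu : R) :
  (forall T, exists t, T < t /\ Q t) ->
  (forall d, 0 < d -> Rbar_locally p_infty (fun t => Q t -> mu - d < f t < mu + d)) ->
  exists x : nat -> R, (forall i, Q (x i)) /\
    filterlim x eventually (Rbar_locally p_infty) /\ is_lim_seq (fun i => f (x i)) mu.
Proof.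
  intros HQ Hmu.
  destruct (functional_choice (fun (i : nat) t => INR i < t /\ Q t) (fun i => HQ (INR i)))
    as [x Hx].
  assert (Hlim : filterlim x eventually (Rbar_locally p_infty)).
  { apply filterlim_nat_p_infty. apply Hx. }
  exists x. split; [apply Hx | split; [exact Hlim |]].
  apply is_lim_seq_spec. intros d. simpl.
  destruct (Hlim _ (Hmu d (cond_pos d))) as [N HN]. exists N.
  intros i Hi. specialize (HN i Hi (proj2 (Hx i))). apply Rabs_def1; lra.
Qed.

(** * Local extrema *)

Lemma derive_pos_increasing_at (f : R -> R) (x l : R) :
  is_derive f x l -> 0 < l ->
  exists d, 0 < d /\ forall h, 0 < h < d -> f (x - h) < f x < f (x + h).
Proof.
  intros Hd Hl. apply is_derive_Reals in Hd.
  destruct (Hd (l / 2)) as [d Hd']; [lra |].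
  exists d. split; [apply cond_pos |]. intros h Hh.
  pose proof (Hd' h ltac:(lra) ltac:(rewrite Rabs_right; lra)) as Hr.
  pose proof (Hd' (- h) ltac:(lra) ltac:(rewrite Rabs_left; lra)) as Hs.
  apply Rabs_def2 in Hr. apply Rabs_def2 in Hs.
  assert (Hr' : 0 < (f (x + h) - f x) / h) by lra.
  assert (Hs' : 0 < (f (x + - h) - f x) / - h) by lra.
  assert (f (x + h) - f x = (f (x + h) - f x) / h * h) by (field; lra).
  assert (f x - f (x - h) = (f (x + - h) - f x) / - h * h)
    by (replace (x + - h) with (x - h) by ring; field; lra).
  split; nra.
Qed.

Lemma is_local_max_derive (f : R -> R) (x l : R) :
  is_derive f x l -> is_local_max f x -> l <= 0.
Proof.
  intros Hd [e He]. apply Rnot_lt_le. intros Hl.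
  destruct (derive_pos_increasing_at f x l Hd Hl) as [d [Hd0 Hd']].
  pose proof (cond_pos e).
  set (h := Rmin d e / 2).
  assert (Hh : 0 < h /\ h < d /\ h < e).
  { unfold h. pose proof (Rmin_l d e). pose proof (Rmin_r d e).
    assert (0 < Rmin d e) by (apply Rmin_pos; lra). lra. }
  specialize (Hd' h ltac:(lra)).
  assert (f (x + h) <= f x).
  { apply He. change (Rabs (x + h - x) < e).
    replace (x + h - x) with h by ring. rewrite Rabs_right; lra. }
  lra.
Qed.

(** Reflecting [f] about [x] keeps the maximum and reverses the sign of the
    derivative, so the one-sided estimate applies twice. *)
Lemma is_local_max_derive_eq_0 (f : R -> R) (x l : R) :
  is_derive f x l -> is_local_max f x -> l = 0.
Proof.
  intros Hd Hx. apply Rle_antisym; [now apply (is_local_max_derive f x) |].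
  enough (- l <= 0) by lra.
  apply (is_local_max_derive (fun y => f (2 * x - y)) x).
  - evar_last.
    + apply (is_derive_comp f (fun y => 2 * x - y)).
      * replace (2 * x - x) with x by ring. exact Hd.
      * auto_derive; [easy | reflexivity].
    + unfold scal; simpl; unfold mult; simpl. ring.
  - destruct Hx as [e He]. exists e. intros y Hy.
    replace (2 * x - x) with x by ring. apply He.
    change (Rabs (y - x) < e) in Hy. change (Rabs (2 * x - y - x) < e).
    replace (2 * x - y - x) with (- (y - x)) by ring. now rewrite Rabs_Ropp.
Qed.

Lemma is_local_max_second_derive (f g : R -> R) (x l : R) :
  (forall y, is_derive f y (g y)) -> is_derive g x l -> is_local_max f x -> l <= 0.
Proof.
  intros Hf Hg Hx. apply Rnot_lt_le. intros Hl.
  assert (Hgx : g x = 0) by now apply (is_local_max_derive_eq_0 f x).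
  destruct (derive_pos_increasing_at g x l Hg Hl) as [d [Hd0 Hd']].
  destruct Hx as [e He]. pose proof (cond_pos e).
  set (h := Rmin d e / 2).
  assert (Hh : 0 < h /\ h < d /\ h < e).
  { unfold h. pose proof (Rmin_l d e). pose proof (Rmin_r d e).
    assert (0 < Rmin d e) by (apply Rmin_pos; lra). lra. }
  assert (Hle : f (x + h) <= f x).
  { apply He. change (Rabs (x + h - x) < e).
    replace (x + h - x) with h by ring. rewrite Rabs_right; lra. }
  destruct (MVT_cor2 f g x (x + h)) as [c [Hc Hcx]]; [lra | |].
  { intros. now apply is_derive_Reals. }
  specialize (Hd' (c - x) ltac:(lra)). replace (x + (c - x)) with c in Hd' by ring.
  nra.
Qed.

Lemma is_local_min_opp (f : R -> R) (x : R) :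
  is_local_min f x <-> is_local_max (fun y => - f y) x.
Proof.
  split; intros H; unfold is_local_min, is_local_max in *; revert H; apply filter_imp;
    intros y Hy; lra.
Qed.

(** The signs of the derivative at the ends keep the maximum of [f] over the closed
    interval away from them. In this way a change of sign of the velocity yields
    a local extremum of the orbit. *)
Lemma exists_local_max (f g : R -> R) (x y : R) :
  (forall t, is_derive f t (g t)) -> x < y -> 0 < g x -> g y < 0 ->
  exists t, x < t < y /\ is_local_max f t.
Proof.
  intros Hf Hxy Hgx Hgy.
  destruct (continuity_ab_maj f x y) as [t [Ht Htxy]]; [lra | |].
  { intros c _. apply derivable_continuous_pt. exists (g c). apply is_derive_Reals, Hf. }
  assert (Hxt : x <> t).
  { intros <-. destruct (derive_pos_increasing_at f x (g x)) as [d [Hd0 Hd]]; [easy.. |].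
    pose proof (Rmin_l d (y - x)). pose proof (Rmin_r d (y - x)).
    assert (0 < Rmin d (y - x)) by (apply Rmin_pos; lra).
    specialize (Hd (Rmin d (y - x) / 2) ltac:(lra)).
    specialize (Ht (x + Rmin d (y - x) / 2) ltac:(lra)). lra. }
  assert (Hty : t <> y).
  { intros ->. destruct (derive_pos_increasing_at (fun t => - f t) y (- g y)) as [d [Hd0 Hd]].
    - apply (is_derive_opp f y (g y)), Hf.
    - lra.
    - pose proof (Rmin_l d (y - x)). pose proof (Rmin_r d (y - x)).
      assert (0 < Rmin d (y - x)) by (apply Rmin_pos; lra).
      specialize (Hd (Rmin d (y - x) / 2) ltac:(lra)).
      specialize (Ht (y - Rmin d (y - x) / 2) ltac:(lra)). lra. }
  exists t. split; [lra |].
  assert (He : 0 < Rmin (t - x) (y - t)) by (apply Rmin_pos; lra).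
  exists (mkposreal _ He). intros z Hz. apply Ht.
  change (Rabs (z - t) < Rmin (t - x) (y - t)) in Hz.
  pose proof (Rmin_l (t - x) (y - t)). pose proof (Rmin_r (t - x) (y - t)).
  apply Rabs_def2 in Hz. lra.
Qed.

Lemma exists_local_min (f g : R -> R) (x y : R) :
  (forall t, is_derive f t (g t)) -> x < y -> g x < 0 -> 0 < g y ->
  exists t, x < t < y /\ is_local_min f t.
Proof.
  intros Hf Hxy Hgx Hgy.
  destruct (exists_local_max (fun t => - f t) (fun t => - g t) x y) as [t [Ht Hmax]];
    [| lra.. |].
  - intros t. apply (is_derive_opp f t (g t)), Hf.
  - exists t. split; [easy |]. now apply is_local_min_opp.
Qed.

Lemma is_local_min_derive_eq_0 (f : R -> R) (x l : R) :
  is_derive f x l -> is_local_min f x -> l = 0.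
Proof.
  intros Hd Hx%is_local_min_opp. apply (is_derive_opp f x l) in Hd.
  pose proof (is_local_max_derive_eq_0 _ _ _ Hd Hx) as H.
  unfold opp in H; simpl in H. lra.
Qed.

Lemma is_local_min_second_derive (f g : R -> R) (x l : R) :
  (forall y, is_derive f y (g y)) -> is_derive g x l -> is_local_min f x -> 0 <= l.
Proof.
  intros Hf Hg Hx%is_local_min_opp. enough (- l <= 0) by lra.
  apply (is_local_max_second_derive (fun y => - f y) (fun y => - g y) x); [| | easy].
  - intros y. apply (is_derive_opp f y (g y)), Hf.
  - now apply (is_derive_opp g x l).
Qed.

(** * Lower and upper limits along a filter *)
Lemma LimInf_eq (F : (R -> Prop) -> Prop) (f : R -> R) (mu : R) :
  (forall e, 0 < e -> F (fun y => mu - e < f y)) ->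
  (forall P e, F P -> 0 < e -> exists y, P y /\ f y < mu + e) ->
  LimInf F f = mu.
Proof.
  intros Hlow Hup. apply Rbar_is_lub_unique. split.
  - intros m [P [HP ->]]. unfold Inf_on.
    destruct (Glb_Rbar_correct (fun y => exists x, P x /\ y = f x)) as [Hlb _].
    assert (Hle : forall e, 0 < e ->
      Rbar_le (Glb_Rbar (fun y => exists x, P x /\ y = f x)) (mu + e)).
    { intros e He. destruct (Hup P e HP He) as [y [Hy Hlt]].
      apply (Rbar_le_trans _ (f y)); [apply Hlb; now exists y | simpl; lra]. }
    destruct (Glb_Rbar _) as [r | |]; simpl in *.
    + apply le_epsilon. exact Hle.
    + apply (Hle 1). lra.
    + easy.
  - intros b Hb.
    assert (Hle : forall e, 0 < e -> Rbar_le (mu - e) b).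
    { intros e He.
      apply (Rbar_le_trans _ (Inf_on (fun y => mu - e < f y) f)).
      - unfold Inf_on.
        apply (Glb_Rbar_correct (fun y => exists x, mu - e < f x /\ y = f x)).
        intros y [x [Hx ->]]. simpl. lra.
      - apply Hb. exists (fun y => mu - e < f y). split; [now apply Hlow | easy]. }
    destruct b as [r | |]; simpl in *.
    + apply le_epsilon. intros e He. specialize (Hle e He). lra.
    + easy.
    + apply (Hle 1). lra.
Qed.

Lemma LimSup_eq (F : (R -> Prop) -> Prop) (f : R -> R) (mu : R) :
  (forall e, 0 < e -> F (fun y => f y < mu + e)) ->
  (forall P e, F P -> 0 < e -> exists y, P y /\ mu - e < f y) ->
  LimSup F f = mu.
Proof.
  intros Hup Hlow. apply Rbar_is_glb_unique. split.
  - intros m [P [HP ->]]. unfold Sup_on.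
    destruct (Lub_Rbar_correct (fun y => exists x, P x /\ y = f x)) as [Hub _].
    assert (Hle : forall e, 0 < e ->
      Rbar_le (mu - e) (Lub_Rbar (fun y => exists x, P x /\ y = f x))).
    { intros e He. destruct (Hlow P e HP He) as [y [Hy Hlt]].
      apply (Rbar_le_trans _ (f y)); [simpl; lra | apply Hub; now exists y]. }
    destruct (Lub_Rbar _) as [r | |]; simpl in *.
    + apply le_epsilon. intros e He. specialize (Hle e He). lra.
    + easy.
    + apply (Hle 1). lra.
  - intros b Hb.
    assert (Hle : forall e, 0 < e -> Rbar_le b (mu + e)).
    { intros e He.
      apply (Rbar_le_trans _ (Sup_on (fun y => f y < mu + e) f)).
      - apply Hb. exists (fun y => f y < mu + e). split; [now apply Hup | easy].
      - unfold Sup_on.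
        apply (Lub_Rbar_correct (fun y => exists x, f x < mu + e /\ y = f x)).
        intros y [x [Hx ->]]. simpl. lra. }
    destruct b as [r | |]; simpl in *.
    + apply le_epsilon. exact Hle.
    + apply (Hle 1). lra.
    + easy.
Qed.

(** * Real powers and the potential *)

Lemma Rpower_pos (x c : R) : 0 < Rpower x c.
Proof. apply exp_pos. Qed.

Lemma Rpower_plus_1 (x c : R) : 0 < x -> Rpower x (c + 1) = x * Rpower x c.
Proof. intros Hx. rewrite Rpower_plus, Rpower_1 by easy. ring. Qed.

Lemma Rpower_plus_2 (x c : R) : 0 < x -> Rpower x (c + 1) = x ^ 2 * Rpower x (c - 1).
Proof.
  intros Hx. replace (c + 1) with (c - 1 + 1 + 1) by ring.
  rewrite !Rpower_plus_1 by easy. ring.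
Qed.

Lemma Rpower_root (y k : R) : 0 < y -> k <> 0 -> Rpower (Rpower y (/ k)) k = y.
Proof. intros Hy Hk. rewrite Rpower_mult, Rinv_l, Rpower_1; easy. Qed.

Lemma Rpower_lt_reg_l (x y k : R) :
  0 < k -> 0 < x -> 0 < y -> Rpower x k < Rpower y k -> x < y.
Proof.
  intros Hk Hx Hy H. apply Rnot_le_lt. intros Hle.
  pose proof (Rle_Rpower_l y x k). lra.
Qed.

Lemma Rpower_le_reg_l (x y k : R) :
  0 < k -> 0 < x -> 0 < y -> Rpower x k <= Rpower y k -> x <= y.
Proof.
  intros Hk Hx Hy H. apply Rnot_lt_le. intros Hlt.
  pose proof (Rlt_Rpower_l y x k). lra.
Qed.

Lemma is_derive_Rpower_comp (f : R -> R) (t c l : R) :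
  is_derive f t l -> 0 < f t ->
  is_derive (fun t => Rpower (f t) c) t (c * Rpower (f t) (c - 1) * l).
Proof.
  intros Hf Hpos. evar_last.
  - apply (is_derive_comp (fun x => Rpower x c) f); [| exact Hf].
    apply is_derive_Reals, derivable_pt_lim_power, Hpos.
  - unfold scal; simpl; unfold mult; simpl. ring.
Qed.

Lemma is_derive_potential (a lam x : R) :
  -1 < a -> 0 < x ->
  is_derive (potential a lam) x (x * (Rpower x (a - 1) - Rpower lam (a - 1))).
Proof.
  intros Ha Hx. unfold potential.
  evar_last.
  - apply (is_derive_minus (fun v => 1 / (a + 1) * Rpower v (a + 1))
      (fun v => Rpower lam (a - 1) / 2 * v ^ 2)).
    + apply (is_derive_scal (fun v => Rpower v (a + 1))).
      apply (is_derive_Rpower_comp (fun v => v)); [apply is_derive_id | easy].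
    + auto_derive; [easy | reflexivity].
  - unfold minus, plus, opp, one; simpl.
    replace (a + 1 - 1) with (a - 1 + 1) by ring. rewrite Rpower_plus_1 by easy.
    field. lra.
Qed.

Section Potential.
Context (a lam : R) (Ha : 1 < a) (Hlam : 0 < lam).
Let P := potential a lam.

Lemma potential_decreasing (x y : R) : 0 < x < y -> y <= lam -> P y < P x.
Proof.
  intros Hxy Hy.
  destruct (MVT_cor2 P (fun x => x * (Rpower x (a - 1) - Rpower lam (a - 1))) x y)
    as [c [Hc Hcxy]]; [lra | |].
  { intros c Hc. apply is_derive_Reals, is_derive_potential; lra. }
  assert (Rpower c (a - 1) < Rpower lam (a - 1)) by (apply Rlt_Rpower_l; lra).
  assert (0 < c * (Rpower lam (a - 1) - Rpower c (a - 1)) * (y - x))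
    by (repeat apply Rmult_lt_0_compat; lra).
  lra.
Qed.

Lemma potential_increasing (x y : R) : lam <= x < y -> P x < P y.
Proof.
  intros Hxy.
  destruct (MVT_cor2 P (fun x => x * (Rpower x (a - 1) - Rpower lam (a - 1))) x y)
    as [c [Hc Hcxy]]; [lra | |].
  { intros c Hc. apply is_derive_Reals, is_derive_potential; lra. }
  assert (Rpower lam (a - 1) < Rpower c (a - 1)) by (apply Rlt_Rpower_l; lra).
  assert (0 < c * (Rpower c (a - 1) - Rpower lam (a - 1)) * (y - x))
    by (repeat apply Rmult_lt_0_compat; lra).
  lra.
Qed.

Lemma potential_ge_min (x : R) : 0 < x -> P lam <= P x.
Proof.
  intros Hx. destruct (Rtotal_order x lam) as [H | [-> | H]]; [| lra |].
  - pose proof (potential_decreasing x lam). lra.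
  - pose proof (potential_increasing lam x). lra.
Qed.

Lemma potential_factor (x : R) :
  0 < x -> P x = x ^ 2 * (Rpower x (a - 1) / (a + 1) - Rpower lam (a - 1) / 2).
Proof.
  intros Hx. unfold P, potential. rewrite Rpower_plus_2 by easy. field. lra.
Qed.

(** On [(0, lam]] the power term of the potential is at most [2 / (a + 1)] times
    the quadratic one. A quadratic bound absorbs perturbations of higher order
    in [x], however small [x] is. *)
Lemma potential_le_quadratic (x : R) :
  0 < x <= lam -> P x <= - (Rpower lam (a - 1) * (a - 1) / (2 * (a + 1)) * x ^ 2).
Proof.
  intros Hx. rewrite potential_factor by easy.
  assert (Hle : Rpower x (a - 1) <= Rpower lam (a - 1)) by (apply Rle_Rpower_l; lra).
  assert (0 <= x ^ 2 * ((Rpower lam (a - 1) - Rpower x (a - 1)) / (a + 1))).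
  { apply Rmult_le_pos; [apply pow2_ge_0 |]. apply Rdiv_le_0_compat; lra. }
  replace (- (Rpower lam (a - 1) * (a - 1) / (2 * (a + 1)) * x ^ 2))
    with (x ^ 2 * (Rpower x (a - 1) / (a + 1) - Rpower lam (a - 1) / 2)
          + x ^ 2 * ((Rpower lam (a - 1) - Rpower x (a - 1)) / (a + 1))) by (field; lra).
  lra.
Qed.

Lemma potential_neg (x : R) : 0 < x <= lam -> P x < 0.
Proof.
  intros Hx. eapply Rle_lt_trans; [now apply potential_le_quadratic |].
  apply Ropp_lt_gt_0_contravar. apply Rmult_lt_0_compat.
  - apply Rdiv_lt_0_compat; [| lra]. apply Rmult_lt_0_compat; [apply Rpower_pos | lra].
  - apply pow_lt. lra.
Qed.

(** Choosing [x] by the value of [x ^ (a - 1)] turns the bracket of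
    [potential_factor] into [Rabs K + 1], and [x > 1] does the rest. *)
Lemma potential_unbounded (K : R) : exists x, lam < x /\ K < P x.
Proof.
  pose proof (Rpower_pos lam (a - 1)) as Hl. pose proof (Rabs_pos K).
  set (y := (a + 1) * (Rpower lam (a - 1) / 2 + Rabs K + 1)).
  assert (Hy : Rpower lam (a - 1) < y /\ 1 < y)
    by (unfold y; split; pose proof (Rmult_lt_0_compat (a - 1)
          (Rpower lam (a - 1) / 2 + Rabs K + 1) ltac:(lra) ltac:(lra)); lra).
  set (x := Rpower y (/ (a - 1))).
  assert (Hx : 0 < x) by apply Rpower_pos.
  assert (Hxy : Rpower x (a - 1) = y) by (apply Rpower_root; lra).
  assert (H1 : 1 < x).
  { apply (Rpower_lt_reg_l 1 x (a - 1)); [lra.. |].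
    rewrite Hxy. unfold Rpower. rewrite ln_1, Rmult_0_r, exp_0. lra. }
  exists x. split.
  - apply (Rpower_lt_reg_l lam x (a - 1)); lra.
  - rewrite potential_factor, Hxy by easy. unfold y.
    replace ((a + 1) * (Rpower lam (a - 1) / 2 + Rabs K + 1) / (a + 1)
      - Rpower lam (a - 1) / 2) with (Rabs K + 1) by (field; lra).
    pose proof (Rle_abs K). assert (1 < x ^ 2) by nra.
    pose proof (Rmult_lt_0_compat (x ^ 2 - 1) (Rabs K + 1) ltac:(lra) ltac:(lra)). lra.
Qed.

Lemma continuity_pt_potential (x : R) : 0 < x -> continuity_pt P x.
Proof.
  intros Hx. apply derivable_continuous_pt.
  exists (x * (Rpower x (a - 1) - Rpower lam (a - 1))).
  apply is_derive_Reals, is_derive_potential; lra.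
Qed.

Lemma potential_gt_near_0 (K : R) : K < 0 -> exists x, 0 < x < lam /\ K < P x.
Proof.
  intros HK. pose proof (Rpower_pos lam (a - 1)) as Hl.
  set (L := Rpower lam (a - 1)) in *.
  (* Below [1], [P x >= - L x ^ 2 / 2 >= - L x / 2]. *)
  set (x := Rmin (Rmin 1 (lam / 2)) (- K / L)).
  assert (Hx : 0 < x).
  { unfold x. repeat apply Rmin_pos; try lra. apply Rdiv_lt_0_compat; lra. }
  assert (Hx1 : x <= 1) by (unfold x; eapply Rle_trans; [apply Rmin_l | apply Rmin_l]).
  assert (Hx2 : x <= lam / 2) by (unfold x; eapply Rle_trans; [apply Rmin_l | apply Rmin_r]).
  assert (HxK : x <= - K / L) by apply Rmin_r.
  assert (HLx : L * x <= - K).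
  { replace (- K) with (L * (- K / L)) by (field; lra). apply Rmult_le_compat_l; lra. }
  exists x. split; [lra |]. rewrite potential_factor by easy. fold L.
  assert (0 < Rpower x (a - 1) / (a + 1)) by (apply Rdiv_lt_0_compat; [apply Rpower_pos | lra]).
  nra.
Qed.

Lemma potential_level_left (K : R) :
  P lam < K < 0 -> exists x, 0 < x < lam /\ P x = K.
Proof.
  intros HK. destruct (potential_gt_near_0 K) as [x0 [Hx0 HPx0]]; [lra |].
  destruct (IVT_interv (fun x => K - P x) x0 lam) as [x [Hx HPx]]; [| lra.. |].
  - intros x Hx. apply continuity_pt_minus; [apply continuity_pt_const; easy |].
    apply continuity_pt_potential. lra.
  - exists x. assert (x <> lam) by (intros ->; lra). lra.
Qed.

Lemma potential_level_right (K : R) :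
  P lam < K -> exists x, lam < x /\ P x = K.
Proof.
  intros HK. destruct (potential_unbounded K) as [x0 [Hx0 HPx0]].
  destruct (IVT_interv (fun x => P x - K) lam x0) as [x [Hx HPx]]; [| lra.. |].
  - intros x Hx. apply continuity_pt_minus; [| apply continuity_pt_const; easy].
    apply continuity_pt_potential. lra.
  - exists x. assert (x <> lam) by (intros ->; lra). lra.
Qed.

End Potential.

(** * The energy of a perturbed orbit *)

(** The equation of motion as a first-order system: [w] is the velocity of [v],
    [lam] is the positive equilibrium of the limit equation, and time runs over
    the whole line. *)
Record perturbed_orbit (a b lam sigma : R) (v w : R -> R) : Prop := {
  orbit_a : 1 < a;
  orbit_b : 1 < b;
  orbit_lam : 0 < lam;
  orbit_sigma : 0 < sigma;
  orbit_pos : forall t, 0 < v t;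
  orbit_v : forall t, is_derive v t (w t);
  orbit_w : forall t, is_derive w t
    (v t * (Rpower lam (a - 1) - Rpower (v t) (a - 1)
            - exp (- sigma * t) * Rpower (v t) (b - 1)))
}.

Section Orbit.
Context (a b lam sigma : R) (v w : R -> R) (Hvw : perturbed_orbit a b lam sigma v w).
Local Notation P := (potential a lam).
Let Ha := orbit_a _ _ _ _ _ _ Hvw.
Let Hb := orbit_b _ _ _ _ _ _ Hvw.
Let Hlam := orbit_lam _ _ _ _ _ _ Hvw.
Let Hsigma := orbit_sigma _ _ _ _ _ _ Hvw.
Let Hpos := orbit_pos _ _ _ _ _ _ Hvw.
Let Hv := orbit_v _ _ _ _ _ _ Hvw.
Let Hw := orbit_w _ _ _ _ _ _ Hvw.

Definition energy (t : R) : R :=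
  w t ^ 2 / 2 + potential a lam (v t)
  + / (b + 1) * (exp (- sigma * t) * Rpower (v t) (b + 1)).

(** The equation of motion cancels every term that contains the velocity; the
    only loss comes from the explicit decay of the perturbation in time. *)
Lemma is_derive_energy (t : R) :
  is_derive energy t (- (sigma / (b + 1) * (exp (- sigma * t) * Rpower (v t) (b + 1)))).
Proof.
  unfold energy. evar_last.
  - apply (is_derive_plus (fun t => w t ^ 2 / 2 + potential a lam (v t))
      (fun t => / (b + 1) * (exp (- sigma * t) * Rpower (v t) (b + 1)))).
    + apply (is_derive_plus (fun t => w t ^ 2 / 2) (fun t => potential a lam (v t))).
      * apply (is_derive_comp (fun x => x ^ 2 / 2) w t (w t)); [| apply Hw].
        auto_derive; [easy | field].
      * apply (is_derive_comp (potential a lam) v t); [| apply Hv].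
        apply is_derive_potential; [lra | apply Hpos].
    + apply (is_derive_scal (fun t => exp (- sigma * t) * Rpower (v t) (b + 1))).
      apply (is_derive_mult (fun t => exp (- sigma * t)) (fun t => Rpower (v t) (b + 1))).
      * instantiate (1 := - sigma * exp (- sigma * t)). auto_derive; [easy | ring].
      * apply is_derive_Rpower_comp; [apply Hv | apply Hpos].
      * apply Rmult_comm.
  - unfold plus, scal, mult; simpl; unfold mult; simpl.
    replace (b + 1 - 1) with (b - 1 + 1) by ring.
    rewrite (Rpower_plus_1 (v t) (b - 1)) by apply Hpos. field. lra.
Qed.

Lemma energy_decreasing (x y : R) : x < y -> energy y < energy x.
Proof.
  intros Hxy.
  destruct (MVT_cor2 energy (fun t => - (sigma / (b + 1)
    * (exp (- sigma * t) * Rpower (v t) (b + 1)))) x y) as [c [Hc Hcxy]]; [lra | |].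
  { intros c _. apply is_derive_Reals, is_derive_energy. }
  assert (0 < sigma / (b + 1) * (exp (- sigma * c) * Rpower (v c) (b + 1)) * (y - x)).
  { repeat apply Rmult_lt_0_compat; try lra; try apply exp_pos.
    apply Rinv_0_lt_compat. lra. }
  lra.
Qed.

Lemma perturbation_pos (t k : R) : 0 < exp (- sigma * t) * Rpower (v t) k.
Proof. apply Rmult_lt_0_compat; [apply exp_pos | apply Rpower_pos]. Qed.

Lemma energy_ge (t : R) : w t ^ 2 / 2 + P (v t) < energy t.
Proof.
  unfold energy.
  assert (0 < / (b + 1) * (exp (- sigma * t) * Rpower (v t) (b + 1))).
  { apply Rmult_lt_0_compat; [apply Rinv_0_lt_compat; lra | apply perturbation_pos]. }
  lra.
Qed.

Lemma energy_has_limit :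
  exists e : R, is_lim energy p_infty e /\ forall t, e < energy t.
Proof.
  destruct (is_lim_nonincreasing energy 0 (P lam)) as [e [He Hle]].
  - intros x y [_ [Hxy | ->]]; [| lra]. now apply Rlt_le, energy_decreasing.
  - intros t _. pose proof (energy_ge t). pose proof (pow2_ge_0 (w t)).
    pose proof (potential_ge_min a lam Ha Hlam (v t) (Hpos t)). lra.
  - exists e. split; [easy |]. intros t.
    pose proof (Rmax_l 0 (t + 1)). pose proof (Rmax_r 0 (t + 1)).
    pose proof (energy_decreasing t (Rmax 0 (t + 1))).
    pose proof (Hle (Rmax 0 (t + 1))). lra.
Qed.

(** The potential is coercive, and the energy that dominates it decreases. *)
Lemma orbit_bounded : exists M, 0 < M /\ forall t, 0 <= t -> v t < M.
Proof.
  destruct (potential_unbounded a lam Ha Hlam (energy 0)) as [M [HM HPM]].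
  exists M. split; [lra |]. intros t Ht. apply Rnot_le_lt. intros Hle.
  assert (P M <= P (v t)).
  { destruct Hle as [Hlt | <-]; [| lra].
    apply Rlt_le, potential_increasing; lra. }
  pose proof (energy_ge t). pose proof (pow2_ge_0 (w t)).
  assert (energy t <= energy 0).
  { destruct Ht as [Ht | <-]; [| lra]. now apply Rlt_le, energy_decreasing. }
  lra.
Qed.

Lemma is_lim_exp_decay : is_lim (fun t => exp (- sigma * t)) p_infty 0.
Proof.
  apply is_lim_of_eventually. intros e He. exists (- ln e / sigma).
  intros t Ht. pose proof (exp_pos (- sigma * t)).
  assert (- sigma * t < ln e).
  { apply (Rmult_lt_compat_l sigma) in Ht; [| lra].
    replace (sigma * (- ln e / sigma)) with (- ln e) in Ht by (field; lra). lra. }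
  apply exp_increasing in H0. rewrite exp_ln in H0 by lra. lra.
Qed.

Lemma perturbation_vanishes (k : R) :
  0 <= k -> is_lim (fun t => exp (- sigma * t) * Rpower (v t) k) p_infty 0.
Proof.
  intros Hk. destruct orbit_bounded as [M [HM HvM]].
  apply (is_lim_le_le_loc (fun _ => 0) (fun t => exp (- sigma * t) * Rpower M k)).
  - exists 0. intros t Ht. split; [apply Rlt_le, perturbation_pos |].
    apply Rmult_le_compat_l; [apply Rlt_le, exp_pos |].
    apply Rle_Rpower_l; [easy |]. split; [apply Hpos |].
    apply Rlt_le, HvM. lra.
  - apply is_lim_const.
  - evar_last.
    + apply (is_lim_scal_r _ (Rpower M k)), is_lim_exp_decay.
    + simpl. f_equal. ring.
Qed.

Section Limit_energy.
Context (e : R) (He : is_lim energy p_infty e).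

Lemma is_lim_unperturbed_energy :
  is_lim (fun t => w t ^ 2 / 2 + P (v t)) p_infty e.
Proof.
  apply (is_lim_ext (fun t => energy t
    - / (b + 1) * (exp (- sigma * t) * Rpower (v t) (b + 1)))).
  { intros t. unfold energy. ring. }
  evar_last.
  - apply is_lim_minus'; [exact He |].
    apply (is_lim_scal_l _ (/ (b + 1)) _ 0), perturbation_vanishes. lra.
  - simpl. f_equal. ring.
Qed.

Lemma limit_energy_ge : P lam <= e.
Proof.
  apply (is_lim_ge_cst _ _ _ is_lim_unperturbed_energy). intros t.
  pose proof (pow2_ge_0 (w t)).
  pose proof (potential_ge_min a lam Ha Hlam (v t) (Hpos t)). lra.
Qed.

(** A value [x] whose potential exceeds the limit energy is a barrier: reaching
    it would need more energy than is left. *)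
Lemma eventually_below (x : R) :
  lam <= x -> e < P x -> Rbar_locally p_infty (fun t => v t < x).
Proof.
  intros Hx HPx.
  apply (filter_imp (fun t => w t ^ 2 / 2 + P (v t) < P x)).
  - intros t Ht. apply Rnot_le_lt. intros Hle. pose proof (pow2_ge_0 (w t)).
    assert (P x <= P (v t)); [| lra].
    destruct Hle as [Hlt | <-]; [| lra]. apply Rlt_le, potential_increasing; lra.
  - apply (is_lim_eventually_lt _ e); [apply is_lim_unperturbed_energy | easy].
Qed.

Lemma eventually_above (x : R) :
  x <= lam -> (0 < x -> e < P x) -> Rbar_locally p_infty (fun t => x < v t).
Proof.
  intros Hx HPx. destruct (Rle_or_lt x 0) as [Hx0 | Hx0].
  { exists 0. intros t _. pose proof (Hpos t). lra. }
  apply (filter_imp (fun t => w t ^ 2 / 2 + P (v t) < P x)).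
  - intros t Ht. apply Rnot_le_lt. intros Hle. pose proof (pow2_ge_0 (w t)).
    assert (P x <= P (v t)); [| lra].
    destruct Hle as [Hlt | ->]; [| lra]. pose proof (Hpos t).
    apply Rlt_le, potential_decreasing; lra.
  - apply (is_lim_eventually_lt _ e); [apply is_lim_unperturbed_energy | now apply HPx].
Qed.

Lemma is_lim_lam_of_minimal_energy : e = P lam -> is_lim v p_infty lam.
Proof.
  intros Hlim. apply is_lim_of_eventually. intros d Hd.
  apply eventually_and.
  - apply eventually_above; [lra |]. intros Hx. rewrite Hlim.
    apply potential_decreasing; lra.
  - apply eventually_below; [lra |]. rewrite Hlim. apply potential_increasing; lra.
Qed.

End Limit_energy.

(** * Late extrema *)

(** At a minimum the force is nonnegative, and the perturbation only pulls
    downwards, so the unperturbed force is nonnegative too. *)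
Lemma local_min_le_lam (t : R) : is_local_min v t -> w t = 0 /\ v t <= lam.
Proof.
  intros Hmin. split; [apply (is_local_min_derive_eq_0 v t); easy |].
  pose proof (is_local_min_second_derive v w t _ Hv (Hw t) Hmin) as H.
  pose proof (perturbation_pos t (b - 1)). pose proof (Hpos t).
  apply (Rpower_le_reg_l _ _ (a - 1)); [lra.. |].
  apply (Rmult_le_reg_l (v t)); nra.
Qed.

Lemma local_max_force (t : R) : is_local_max v t ->
  w t = 0 /\
  Rpower lam (a - 1) <= Rpower (v t) (a - 1) + exp (- sigma * t) * Rpower (v t) (b - 1).
Proof.
  intros Hmax. split; [apply (is_local_max_derive_eq_0 v t); easy |].
  pose proof (is_local_max_second_derive v w t _ Hv (Hw t) Hmax) as H.
  pose proof (Hpos t). apply (Rmult_le_reg_l (v t)); nra.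
Qed.

(** At a local minimum there is no kinetic energy and [v <= lam], where the
    potential is at most [- kappa * v ^ 2]. The perturbation contributes
    [v ^ 2] times a factor that vanishes as time grows, so it loses against the
    potential even when [v] is itself close to [0]. *)
Lemma eventually_local_min_energy_neg :
  Rbar_locally p_infty (fun t => is_local_min v t -> energy t < 0).
Proof.
  set (kappa := Rpower lam (a - 1) * (a - 1) / (2 * (a + 1))).
  assert (Hk : 0 < kappa).
  { apply Rdiv_lt_0_compat; [| lra].
    apply Rmult_lt_0_compat; [apply Rpower_pos | lra]. }
  apply (filter_imp (fun t => exp (- sigma * t) * Rpower (v t) (b - 1) < kappa * (b + 1))).
  - intros t Ht Hmin. destruct (local_min_le_lam t Hmin) as [Hw0 Hle].
    pose proof (Hpos t) as Hvt.
    pose proof (potential_le_quadratic a lam Ha (v t) ltac:(lra)) as HP. fold kappa in HP.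
    unfold energy. rewrite Hw0, Rpower_plus_2 by easy.
    replace (/ (b + 1) * (exp (- sigma * t) * (v t ^ 2 * Rpower (v t) (b - 1))))
      with (v t ^ 2 * (exp (- sigma * t) * Rpower (v t) (b - 1) / (b + 1))) by (field; lra).
    apply Rlt_div_l in Ht; [| lra].
    assert (0 < v t ^ 2) by now apply pow_lt.
    apply (Rmult_lt_compat_l (v t ^ 2)) in Ht; [| easy]. lra.
  - apply (is_lim_eventually_lt _ 0); [apply perturbation_vanishes; lra |].
    apply Rmult_lt_0_compat; lra.
Qed.

(** At a local maximum the two attractive terms outweigh [lam ^ (a - 1)]; since the
    perturbation vanishes, [v] cannot stay below a fixed [x < lam]. *)
Lemma eventually_local_max_gt (x : R) :
  0 < x < lam -> Rbar_locally p_infty (fun t => is_local_max v t -> x < v t).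
Proof.
  intros Hx.
  assert (Hlt : Rpower x (a - 1) < Rpower lam (a - 1)) by (apply Rlt_Rpower_l; lra).
  apply (filter_imp (fun t => exp (- sigma * t) * Rpower (v t) (b - 1)
    < Rpower lam (a - 1) - Rpower x (a - 1))).
  - intros t Ht Hmax. destruct (local_max_force t Hmax) as [_ Hge].
    apply (Rpower_lt_reg_l _ _ (a - 1)); [lra | lra | apply Hpos | lra].
  - apply (is_lim_eventually_lt _ 0); [apply perturbation_vanishes; lra | lra].
Qed.

(** * Convergent orbits *)
Section Convergent.
Context (L : R) (HL : is_lim v p_infty L).

(** The kinetic energy converges because total and potential energy do, and its
    limit is [0] because [v] converges. *)
Lemma velocity_vanishes (e k : R) :
  is_lim energy p_infty e -> is_lim (fun t => P (v t)) p_infty k ->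
  is_lim w p_infty 0 /\ e = k.
Proof.
  intros He Hk.
  assert (Hsq : is_lim (fun t => w t ^ 2) p_infty (2 * (e - k))).
  { apply (is_lim_ext (fun t => 2 * ((w t ^ 2 / 2 + P (v t)) - P (v t)))); [intros; field |].
    apply (is_lim_scal_l _ 2 _ (e - k)).
    apply is_lim_minus'; [now apply is_lim_unperturbed_energy | easy]. }
  pose proof (is_lim_derive_sq_eq_0 v w L _ Hv HL Hsq) as H0.
  split; [| lra]. apply is_lim_0_of_sq. now rewrite <- H0.
Qed.

(** The velocity tends to [0] and the force converges, so the force tends to [0]:
    the limit is a zero of the limit force. *)
Lemma positive_limit_eq_lam : 0 < L -> L = lam.
Proof.
  intros HL0. destruct energy_has_limit as [e [He _]].
  assert (HP : is_lim (fun t => P (v t)) p_infty (P L)).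
  { apply is_lim_comp_continuity_pt; [exact HL |].
    apply continuity_pt_potential; easy. }
  destruct (velocity_vanishes e (P L) He HP) as [Hw0 _].
  assert (HR : is_lim (fun t => Rpower (v t) (a - 1)) p_infty (Rpower L (a - 1))).
  { apply (is_lim_comp_continuity_pt (fun x => Rpower x (a - 1)) v); [exact HL |].
    apply derivable_continuous_pt.
    eexists. now apply derivable_pt_lim_power. }
  set (F := L * (Rpower lam (a - 1) - Rpower L (a - 1))).
  assert (HF : is_lim (fun t => v t * (Rpower lam (a - 1) - Rpower (v t) (a - 1)
            - exp (- sigma * t) * Rpower (v t) (b - 1))) p_infty F).
  { unfold F. rewrite <- (Rminus_0_r (Rpower lam (a - 1) - Rpower L (a - 1))).
    apply (is_lim_mult _ _ _ (Finite L) (Finite _)); [exact HL | | easy].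
    apply is_lim_minus'; [| apply perturbation_vanishes; lra].
    apply is_lim_minus'; [apply is_lim_const | exact HR]. }
  assert (HF2 : F * F = 0).
  { apply (is_lim_derive_sq_eq_0 w _ 0 _ Hw Hw0).
    eapply is_lim_ext; [| exact (is_lim_mult _ _ _ (Finite F) (Finite F) HF HF I)].
    intros t. simpl. ring. }
  assert (HF0 : Rpower L (a - 1) = Rpower lam (a - 1))
    by (destruct (Rmult_integral _ _ HF2) as [H | H];
        destruct (Rmult_integral _ _ H) as [H' | H']; lra).
  apply Rle_antisym; apply (Rpower_le_reg_l _ _ (a - 1)); lra.
Qed.

Lemma zero_limit_energy (e : R) :
  L = 0 -> is_lim energy p_infty e -> is_lim w p_infty 0 /\ e = 0.
Proof.
  intros H0 He. apply (velocity_vanishes e 0 He).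
  apply (is_lim_le_le_loc (fun t => - (Rpower lam (a - 1) / 2) * (v t * v t)) (fun _ => 0)).
  - apply (filter_imp (fun t => v t < lam)).
    + intros t Ht. pose proof (Hpos t). split.
      * rewrite potential_factor by lra.
        assert (0 < v t ^ 2 * (Rpower (v t) (a - 1) / (a + 1))).
        { apply Rmult_lt_0_compat; [now apply pow_lt |].
          apply Rdiv_lt_0_compat; [apply Rpower_pos | lra]. }
        lra.
      * apply Rlt_le, potential_neg; lra.
    + apply (is_lim_eventually_lt _ L); [easy | lra].
  - evar_last.
    + apply is_lim_scal_l. exact (is_lim_mult _ _ _ (Finite L) (Finite L) HL HL I).
    + simpl. f_equal. rewrite H0. ring.
  - apply is_lim_const.
Qed.

End Convergent.
(** * Orbits that tend to zero *)
Section Decay.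
Context (m : R) (Hm : 0 < m) (Hm2 : m ^ 2 = Rpower lam (a - 1))
  (Hv0 : is_lim v p_infty 0) (Hw0 : is_lim w p_infty 0).

(** The quantity [exp (- m t) * (w + m v)] is nonincreasing, because the nonlinear
    terms are attractive, and it tends to [0]; so it is nonnegative. *)
Lemma slope_ge (t : R) : 0 <= w t + m * v t.
Proof.
  set (f := fun t => exp (- m * t) * (w t + m * v t)).
  set (g := fun t => v t * (Rpower (v t) (a - 1)
    + exp (- sigma * t) * Rpower (v t) (b - 1))).
  assert (Hf : forall t, is_derive f t (- (exp (- m * t) * g t))).
  { intros s. unfold f, g. evar_last.
    - apply (is_derive_mult (fun t => exp (- m * t)) (fun t => w t + m * v t)).
      + instantiate (1 := - m * exp (- m * s)). auto_derive; [easy | ring].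
      + apply (is_derive_plus w (fun t => m * v t)); [apply Hw |].
        apply is_derive_scal, Hv.
      + apply Rmult_comm.
    - unfold plus, scal, mult; simpl; unfold mult; simpl. rewrite <- Hm2. ring. }
  assert (Hdecr : forall x y, t <= x <= y -> - f x <= - f y).
  { apply (nondecreasing_of_derive _ (fun t => exp (- m * t) * g t)).
    - intros x _. rewrite <- (Ropp_involutive (exp (- m * x) * g x)).
      apply (is_derive_opp f x), Hf.
    - intros x _. apply Rmult_le_pos; [apply Rlt_le, exp_pos |].
      unfold g. pose proof (Hpos x). pose proof (Rpower_pos (v x) (a - 1)).
      pose proof (perturbation_pos x (b - 1)). nra. }
  apply Rnot_lt_le. intros Hlt.
  assert (Hft : f t < 0).
  { pose proof (exp_pos (- m * t)). unfold f. nra. }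
  (* [f] would stay below [f t < 0], although [w + m v] tends to [0] and
     [exp (- m t)] is bounded. *)
  assert (Hlim : is_lim (fun t => w t + m * v t) p_infty (0 + m * 0)).
  { apply is_lim_plus'; [exact Hw0 |]. now apply (is_lim_scal_l v m _ 0). }
  replace (0 + m * 0) with 0 in Hlim by ring.
  set (d := - f t / exp (- m * t)).
  assert (Hd : 0 < d) by (apply Rdiv_lt_0_compat; [lra | apply exp_pos]).
  destruct (is_lim_eventually_gt _ 0 (- d) Hlim ltac:(lra)) as [T HT].
  set (s := Rmax T t + 1).
  assert (Hs : T < s /\ t < s).
  { unfold s. pose proof (Rmax_l T t). pose proof (Rmax_r T t). lra. }
  specialize (HT s ltac:(lra)). specialize (Hdecr t s ltac:(lra)).
  assert (exp (- m * s) < exp (- m * t)) by (apply exp_increasing; nra).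
  pose proof (exp_pos (- m * s)).
  assert (f t = - (exp (- m * t) * d)) by (unfold d; field; apply Rgt_not_eq, exp_pos).
  unfold f in Hdecr at 2. nra.
Qed.

Context (HE : forall t, 0 < energy t) (Hle : Rbar_locally p_infty (fun t => w t <= 0)).

(** Positivity of the energy bounds [m ^ 2 * v ^ 2 - w ^ 2] by the nonlinear terms.
    This difference is the product of [w + m v] and [m v - w], and [m v - w] is at
    least [m v] when [w <= 0]. *)
Lemma slope_le (t : R) :
  w t <= 0 ->
  m * (w t + m * v t)
    <= v t * (Rpower (v t) (a - 1) + exp (- sigma * t) * Rpower (v t) (b - 1)).
Proof.
  intros Hwt. pose proof (slope_ge t) as Hs. pose proof (Hpos t) as Hvt.
  specialize (HE t). unfold energy in HE.
  rewrite potential_factor, Rpower_plus_2, <- Hm2 in HE by lra.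
  set (A := Rpower (v t) (a - 1)) in *.
  set (B := Rpower (v t) (b - 1)) in *.
  set (X := exp (- sigma * t)) in *.
  assert (HA : 0 < A) by apply Rpower_pos.
  assert (HB : 0 < X * B) by apply perturbation_pos.
  assert (HA2 : A / (a + 1) <= A / 2).
  { apply Rmult_le_compat_l; [lra |]. apply Rinv_le_contravar; lra. }
  assert (HB2 : X * B / (b + 1) <= X * B / 2).
  { apply Rmult_le_compat_l; [lra |]. apply Rinv_le_contravar; lra. }
  assert (H2 : m ^ 2 * v t ^ 2 - w t ^ 2 <= v t ^ 2 * (A + X * B)).
  { replace (/ (b + 1) * (X * (v t ^ 2 * B))) with (v t ^ 2 * (X * B / (b + 1))) in HE
      by (field; lra).
    pose proof (pow_lt (v t) 2 Hvt). nra. }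
  apply (Rmult_le_reg_l (v t)); [easy |].
  assert (0 <= (w t + m * v t) * - w t) by (apply Rmult_le_pos; lra).
  lra.
Qed.

(** [exp (m t) * v t] is nondecreasing by [slope_ge]; it remains to bound it. By
    [slope_le] its logarithmic derivative is at most
    [(v ^ (a - 1) + exp (- sigma t)) / m] once [v <= 1]. As soon as [w / v] is below
    [- m / 2], each of these terms is bounded by minus the derivative of a multiple
    of [v ^ (a - 1)] or of [exp (- sigma t)]. Adding these multiples to the
    logarithm gives the nonincreasing function [phi] of the proof. *)
Lemma fast_decay : exists c, 0 < c /\ is_lim (fun t => exp (m * t) * v t) p_infty c.
Proof.
  set (K := 2 / (m ^ 2 * (a - 1))). set (K' := / (m * sigma)).
  set (phi := fun t => m * t + ln (v t) + K * Rpower (v t) (a - 1)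
                       + K' * exp (- sigma * t)).
  set (dphi := fun t => m + w t / v t
    + K * ((a - 1) * Rpower (v t) (a - 1 - 1) * w t)
    + K' * (- sigma * exp (- sigma * t))).
  assert (HK : 0 < K).
  { apply Rdiv_lt_0_compat; [lra |]. apply Rmult_lt_0_compat; [apply pow_lt |]; lra. }
  assert (HK' : 0 < K') by (apply Rinv_0_lt_compat; nra).
  assert (Hphi : forall t, is_derive phi t (dphi t)).
  { intros t. unfold phi, dphi.
    apply (is_derive_plus (fun t => m * t + ln (v t) + K * Rpower (v t) (a - 1))
      (fun t => K' * exp (- sigma * t))).
    - apply (is_derive_plus (fun t => m * t + ln (v t)) (fun t => K * Rpower (v t) (a - 1))).
      + apply (is_derive_plus (fun t => m * t) (fun t => ln (v t))).
        * auto_derive; [easy | ring].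
        * evar_last.
          -- apply (is_derive_comp ln v); [apply is_derive_ln, Hpos | apply Hv].
          -- reflexivity.
      + apply (is_derive_scal (fun t => Rpower (v t) (a - 1))).
        apply is_derive_Rpower_comp; [apply Hv | apply Hpos].
    - auto_derive; [easy | ring]. }
  set (d := Rmin 1 (Rpower (m ^ 2 / 4) (/ (a - 1)))).
  assert (Hm20 : 0 < m ^ 2) by (apply pow_lt; lra).
  assert (Hd : 0 < d) by (apply Rmin_pos; [lra | apply Rpower_pos]).
  destruct (eventually_and _ _ Hle (eventually_and _ _
    (is_lim_eventually_lt v 0 d Hv0 Hd)
    (is_lim_eventually_lt _ 0 (Rmin 1 (m ^ 2 / 4)) is_lim_exp_decay
       ltac:(apply Rmin_pos; lra)))) as [T HT].
  assert (Hneg : forall t, T + 1 <= t -> dphi t <= 0).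
  { intros t Ht. destruct (HT t ltac:(lra)) as [Hwt [Hvt Het]].
    pose proof (Rmin_l 1 (Rpower (m ^ 2 / 4) (/ (a - 1)))) as Hd1.
    pose proof (Rmin_r 1 (Rpower (m ^ 2 / 4) (/ (a - 1)))) as Hd2. fold d in Hd1, Hd2.
    pose proof (Rmin_l 1 (m ^ 2 / 4)). pose proof (Rmin_r 1 (m ^ 2 / 4)).
    pose proof (Hpos t) as Hp. pose proof (slope_le t Hwt) as Hs.
    assert (HA : Rpower (v t) (a - 1) < m ^ 2 / 4).
    { rewrite <- (Rpower_root (m ^ 2 / 4) (a - 1)) by lra. apply Rlt_Rpower_l; lra. }
    assert (HB : Rpower (v t) (b - 1) <= 1).
    { rewrite <- (Rpower_1 1) at 2 by lra. unfold Rpower at 2. rewrite ln_1, Rmult_0_r.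
      rewrite <- (Rmult_0_r (b - 1)), <- ln_1. apply Rle_Rpower_l; lra. }
    unfold dphi.
    assert (HR : Rpower (v t) (a - 1) = v t * Rpower (v t) (a - 1 - 1)).
    { replace (a - 1) with (a - 1 - 1 + 1) at 1 by ring. now apply Rpower_plus_1. }
    set (y := w t / v t).
    assert (Hy : w t = v t * y) by (unfold y; field; lra).
    replace (K * ((a - 1) * Rpower (v t) (a - 1 - 1) * w t))
      with (K * (a - 1) * (Rpower (v t) (a - 1) * y)) by (rewrite HR, Hy; ring).
    set (A := Rpower (v t) (a - 1)) in *. set (B := Rpower (v t) (b - 1)) in *.
    set (X := exp (- sigma * t)) in *.
    assert (HX : 0 < X) by apply exp_pos. assert (HA0 : 0 < A) by apply Rpower_pos.
    assert (HB0 : 0 < B) by apply Rpower_pos.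
    assert (Hmy : m * (m + y) <= A + X).
    { apply (Rmult_le_reg_l (v t)); [easy |].
      replace (v t * (m * (m + y))) with (m * (w t + m * v t)) by (rewrite Hy; ring).
      eapply Rle_trans; [exact Hs |]. apply Rmult_le_compat_l; [lra |]. nra. }
    (* [A] and [X] are below [m ^ 2 / 4], whence [m + y <= m / 2]. *)
    assert (Hy2 : y <= - (m / 2)) by nra.
    replace (K * (a - 1)) with (2 / m ^ 2) by (unfold K; field; lra).
    replace (K' * (- sigma * X)) with (- (X / m)) by (unfold K'; field; lra).
    assert (m + y <= A / m + X / m).
    { apply (Rmult_le_reg_l m); [lra |].
      replace (m * (A / m + X / m)) with (A + X) by (field; lra). easy. }
    assert (2 / m ^ 2 * (A * y) <= - (A / m)).
    { replace (- (A / m)) with (2 / m ^ 2 * (A * - (m / 2))) by (field; lra).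
      apply Rmult_le_compat_l; [apply Rlt_le, Rdiv_lt_0_compat; lra |].
      apply Rmult_le_compat_l; lra. }
    lra. }
  assert (Hdecr : forall x y, T + 1 <= x <= y -> - phi x <= - phi y).
  { apply (nondecreasing_of_derive _ (fun t => - dphi t)).
    - intros x _. apply (is_derive_opp phi x), Hphi.
    - intros x Hx. specialize (Hneg x Hx). lra. }
  destruct (is_lim_nondecreasing (fun t => exp (m * t) * v t) (T + 1) (exp (phi (T + 1))))
    as [c [Hc Hcle]].
  - apply (nondecreasing_of_derive _ (fun t => exp (m * t) * (w t + m * v t))).
    + intros x _. evar_last.
      * apply (is_derive_mult (fun t => exp (m * t)) v).
        -- instantiate (1 := m * exp (m * x)). auto_derive; [easy | ring].
        -- apply Hv.
        -- apply Rmult_comm.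
      * unfold plus, scal, mult; simpl; unfold mult; simpl. ring.
    + intros x _. apply Rmult_le_pos; [apply Rlt_le, exp_pos | apply slope_ge].
  - intros x Hx. specialize (Hdecr (T + 1) x ltac:(lra)).
    pose proof (Hpos x).
    rewrite <- (exp_ln (v x)) at 1 by easy. rewrite <- exp_plus.
    apply Rnot_lt_le. intros Hlt. apply exp_lt_inv in Hlt.
    assert (m * x + ln (v x) < phi x); [| lra].
    unfold phi.
    pose proof (Rmult_lt_0_compat _ _ HK (Rpower_pos (v x) (a - 1))).
    pose proof (Rmult_lt_0_compat _ _ HK' (exp_pos (- sigma * x))). lra.
  - exists c. split; [| exact Hc].
    apply (Rlt_le_trans _ (exp (m * (T + 1)) * v (T + 1))).
    + apply Rmult_lt_0_compat; [apply exp_pos | apply Hpos].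
    + apply Hcle. lra.
Qed.

End Decay.
(** * Oscillating orbits *)
Section Oscillation.
Context (Hup : forall T, exists t, T < t /\ 0 < w t)
  (Hdown : forall T, exists t, T < t /\ w t < 0).

Lemma local_max_frequent (T : R) : exists t, T < t /\ is_local_max v t.
Proof.
  destruct (Hup T) as [x [Hx Hwx]]. destruct (Hdown x) as [y [Hy Hwy]].
  destruct (exists_local_max v w x y Hv Hy Hwx Hwy) as [t [Ht Hmax]].
  exists t. split; [lra | easy].
Qed.

Lemma local_min_frequent (T : R) : exists t, T < t /\ is_local_min v t.
Proof.
  destruct (Hdown T) as [x [Hx Hwx]]. destruct (Hup x) as [y [Hy Hwy]].
  destruct (exists_local_min v w x y Hv Hy Hwx Hwy) as [t [Ht Hmin]].
  exists t. split; [lra | easy].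
Qed.

Context (e : R) (He : is_lim energy p_infty e).

(** The limit energy lies below the energy at any time, in particular below its
    negative value at a late local minimum. *)
Lemma oscillation_energy_neg : (forall t, e < energy t) -> e < 0.
Proof.
  intros Hlt. destruct eventually_local_min_energy_neg as [T HT].
  destruct (local_min_frequent T) as [t [Ht Hmin]].
  specialize (HT t Ht Hmin). specialize (Hlt t). lra.
Qed.

Context (mu1 mu2 : R) (Hmu1 : 0 < mu1 < lam) (Hmu2 : lam < mu2)
  (HP1 : P mu1 = e) (HP2 : P mu2 = e).

Lemma eventually_between (d : R) :
  0 < d -> Rbar_locally p_infty (fun t => mu1 - d < v t < mu2 + d).
Proof.
  intros Hd. apply eventually_and.
  - apply (eventually_above e He); [lra |]. intros H. rewrite <- HP1.
    apply potential_decreasing; lra.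
  - apply (eventually_below e He); [lra |]. rewrite <- HP2.
    apply potential_increasing; lra.
Qed.

(** At a local minimum the energy is potential energy, hence close to [e], and
    [v <= lam]; the decreasing branch of the potential then locates [v]. *)
Lemma eventually_local_min_near (d : R) :
  0 < d -> Rbar_locally p_infty (fun t => is_local_min v t -> v t < mu1 + d).
Proof.
  intros Hd. set (x := Rmin (mu1 + d) lam).
  assert (Hx : mu1 < x) by (apply Rmin_glb_lt; lra).
  pose proof (Rmin_l (mu1 + d) lam). pose proof (Rmin_r (mu1 + d) lam). fold x in H, H0.
  apply (filter_imp (fun t => P x < w t ^ 2 / 2 + P (v t))).
  - intros t Ht Hmin. destruct (local_min_le_lam t Hmin) as [Hw0 Hle].
    rewrite Hw0 in Ht. enough (v t < x) by lra. apply Rnot_le_lt. intros [Hlt | Heq].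
    + pose proof (potential_decreasing a lam Ha x (v t)). lra.
    + rewrite <- Heq in Ht. lra.
  - apply (is_lim_eventually_gt _ e); [now apply is_lim_unperturbed_energy |].
    rewrite <- HP1. apply potential_decreasing; lra.
Qed.

(** At a local maximum the potential is again close to [e]. This leaves a
    neighbourhood of [mu1] or of [mu2], and the first one lies below the midpoint
    [y] of [mu1] and [lam], where late local maxima do not occur. *)
Lemma eventually_local_max_near (d : R) :
  0 < d -> Rbar_locally p_infty (fun t => is_local_max v t -> lam < v t /\ mu2 - d < v t).
Proof.
  intros Hd. set (x := Rmax (mu2 - d) lam). set (y := (mu1 + lam) / 2).
  assert (Hx : x < mu2) by (apply Rmax_lub_lt; lra).
  pose proof (Rmax_l (mu2 - d) lam). pose proof (Rmax_r (mu2 - d) lam). fold x in H, H0.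
  assert (Hy : mu1 < y < lam) by (unfold y; lra).
  pose proof (is_lim_unperturbed_energy e He) as HH.
  apply (filter_imp (fun t => (P x < w t ^ 2 / 2 + P (v t) /\ P y < w t ^ 2 / 2 + P (v t))
    /\ (is_local_max v t -> y < v t))).
  - intros t [[Hxt Hyt] Hmax'] Hmax. specialize (Hmax' Hmax).
    destruct (local_max_force t Hmax) as [Hw0 _]. rewrite Hw0 in Hxt, Hyt.
    assert (Hlt : lam < v t).
    { apply Rnot_le_lt. intros Hle.
      pose proof (potential_decreasing a lam Ha y (v t)). lra. }
    enough (x < v t) by lra. apply Rnot_le_lt. intros [Hlt' | Heq].
    + pose proof (potential_increasing a lam Ha Hlam (v t) x). lra.
    + rewrite Heq in Hxt. lra.
  - apply eventually_and; [apply eventually_and |].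
    + apply (is_lim_eventually_gt _ e); [easy |].
      rewrite <- HP2. apply potential_increasing; lra.
    + apply (is_lim_eventually_gt _ e); [easy |].
      rewrite <- HP1. apply potential_decreasing; lra.
    + apply eventually_local_max_gt. lra.
Qed.

(** The maxima are taken after the time from which they exceed [lam]. Minima are
    at most [lam], so the strict inequality holds for every index. *)
Lemma oscillation_sequences :
  exists eta eps : nat -> R,
    filterlim eta eventually (Rbar_locally p_infty) /\
    filterlim eps eventually (Rbar_locally p_infty) /\
    (forall i, is_local_min v (eta i) /\ is_local_max v (eps i) /\ v (eta i) < v (eps i)) /\
    is_lim_seq (fun i => v (eta i)) mu1 /\ is_lim_seq (fun i => v (eps i)) mu2.
Proof.
  destruct (eventually_local_max_near 1 Rlt_0_1) as [T HT].
  destruct (exists_convergent_values v (is_local_min v) mu1 local_min_frequent)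
    as [eta [Heta [Heta_lim Heta_mu]]].
  { intros d Hd. generalize (eventually_and _ _ (eventually_between d Hd)
      (eventually_local_min_near d Hd)).
    apply filter_imp. intros t [Ht Hmin] Hq. specialize (Hmin Hq). lra. }
  destruct (exists_convergent_values v (fun t => T < t /\ is_local_max v t) mu2)
    as [eps [Heps [Heps_lim Heps_mu]]].
  { intros T'. destruct (local_max_frequent (Rmax T T')) as [t [Ht Hmax]].
    pose proof (Rmax_l T T'). pose proof (Rmax_r T T').
    exists t. repeat split; [lra.. | easy]. }
  { intros d Hd. generalize (eventually_and _ _ (eventually_between d Hd)
      (eventually_local_max_near d Hd)).
    apply filter_imp. intros t [Ht Hmax] [_ Hq]. specialize (Hmax Hq). lra. }
  exists eta, eps. repeat split; try easy.
  - apply Heps.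
  - destruct (Heps i) as [Hi Hmax]. destruct (HT _ Hi Hmax) as [Hgt _].
    destruct (local_min_le_lam _ (Heta i)) as [_ Hle]. lra.
Qed.

End Oscillation.

Theorem orbit_trichotomy (m : R) : 0 < m -> m ^ 2 = Rpower lam (a - 1) ->
  is_lim v p_infty lam \/
  (exists c, 0 < c /\ is_lim (fun t => exp (m * t) * v t) p_infty c) \/
  exists (mu1 mu2 : R) (eta eps : nat -> R),
    0 < mu1 < lam /\ lam < mu2 /\ P mu1 = P mu2 /\ P mu2 < 0 /\
    (forall d, 0 < d -> Rbar_locally p_infty (fun t => mu1 - d < v t < mu2 + d)) /\
    filterlim eta eventually (Rbar_locally p_infty) /\
    filterlim eps eventually (Rbar_locally p_infty) /\
    (forall i, is_local_min v (eta i) /\ is_local_max v (eps i) /\ v (eta i) < v (eps i)) /\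
    is_lim_seq (fun i => v (eta i)) mu1 /\ is_lim_seq (fun i => v (eps i)) mu2.
Proof.
  intros Hm Hm2. destruct energy_has_limit as [e [He Hlt]].
  destruct orbit_bounded as [M [HM HvM]].
  destruct (classic (exists T, forall t, T < t -> 0 <= w t)) as [[T HT] | Hdown].
  { (* An eventually increasing orbit cannot tend to [0]. *)
    left. destruct (is_lim_nondecreasing v (Rmax 0 (T + 1)) M) as [L [HL HLv]].
    - apply (nondecreasing_of_derive v w); [intros; apply Hv |].
      intros x Hx. apply HT. pose proof (Rmax_r 0 (T + 1)). lra.
    - intros x Hx. apply Rlt_le, HvM. pose proof (Rmax_l 0 (T + 1)). lra.
    - rewrite <- (positive_limit_eq_lam L HL); [easy |].
      eapply Rlt_le_trans; [apply Hpos | apply HLv, Rle_refl]. }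
  destruct (classic (exists T, forall t, T < t -> w t <= 0)) as [[T HT] | Hup].
  { destruct (is_lim_nonincreasing v (T + 1) 0) as [L [HL HLv]].
    - intros x y Hxy. apply Ropp_le_cancel. revert x y Hxy.
      apply (nondecreasing_of_derive _ (fun t => - w t)).
      + intros x _. apply (is_derive_opp v x), Hv.
      + intros x Hx. specialize (HT x). lra.
    - intros x _. apply Rlt_le, Hpos.
    - assert (HL0 : 0 <= L).
      { apply (is_lim_ge_cst v L 0 HL). intros t. apply Rlt_le, Hpos. }
      destruct HL0 as [HL0 | HL0].
      + left. now rewrite <- (positive_limit_eq_lam L HL HL0).
      + right. left. symmetry in HL0.
        destruct (zero_limit_energy L HL e HL0 He) as [Hw0 He0].
        apply (fast_decay m Hm Hm2); [now rewrite <- HL0 | easy | | now exists T].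
        intros t. specialize (Hlt t). lra. }
  assert (Hup' : forall T, exists t, T < t /\ 0 < w t).
  { intros T. apply NNPP. intros H. apply Hup. exists T. intros t Ht.
    apply Rnot_lt_le. intros Hwt. apply H. now exists t. }
  assert (Hdown' : forall T, exists t, T < t /\ w t < 0).
  { intros T. apply NNPP. intros H. apply Hdown. exists T. intros t Ht.
    apply Rnot_lt_le. intros Hwt. apply H. now exists t. }
  assert (He0 : e < 0) by now apply oscillation_energy_neg.
  destruct (limit_energy_ge e He) as [Hgt | Heq].
  - right. right.
    destruct (potential_level_left a lam Ha Hlam e) as [mu1 [Hmu1 HP1]]; [easy |].
    destruct (potential_level_right a lam Ha Hlam e) as [mu2 [Hmu2 HP2]]; [easy |].
    destruct (oscillation_sequences Hup' Hdown' e He mu1 mu2) as [eta [eps Hseq]];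
      [easy.. |].
    exists mu1, mu2, eta, eps. rewrite HP1, HP2.
    split; [easy |]. split; [easy |]. split; [easy |]. split; [easy |]. split; [| easy].
    now apply (eventually_between e He mu1 mu2).
  - left. now apply (is_lim_lam_of_minimal_energy e He).
Qed.

End Orbit.
(** * Back to the radius *)
Section Logarithmic_time.
Context (k : R) (Hk : k * k = 1) (F : (R -> Prop) -> Prop) (FF : ProperFilter F)
  (Fexp : filterlim (fun t => exp (k * t)) (Rbar_locally p_infty) F)
  (Fln : filterlim (fun r => k * ln r) F (Rbar_locally p_infty))
  (Fpos : F (fun r => 0 < r)) (V : R -> R).
Let v (t : R) : R := V (exp (k * t)).

Lemma log_time_eq (r : R) : 0 < r -> v (k * ln r) = V r.
Proof.
  intros Hr. unfold v. rewrite <- Rmult_assoc, Hk, Rmult_1_l. now rewrite exp_ln.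
Qed.

Lemma log_time_eventually (P : R -> Prop) :
  Rbar_locally p_infty (fun t => P (v t)) -> F (fun r => P (V r)).
Proof.
  intros HP. assert (HPv : F (fun r => P (v (k * ln r)))) by exact (Fln _ HP).
  generalize (filter_and _ _ Fpos HPv). apply filter_imp.
  intros r [Hr HPr]. now rewrite log_time_eq in HPr.
Qed.

Lemma log_time_filterlim (h : R -> R) (l : R) :
  is_lim (fun t => h t * v t) p_infty l ->
  filterlim (fun r => h (k * ln r) * V r) F (locally l).
Proof.
  intros Hl. apply (filterlim_ext_loc (fun r => h (k * ln r) * v (k * ln r))).
  - revert Fpos. apply filter_imp. intros r Hr. now rewrite log_time_eq.
  - exact (filterlim_comp _ _ _ (fun r => k * ln r) (fun t => h t * v t) _ _ _ Fln Hl).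
Qed.

(** Since [r |-> k ln r] is continuous, it pulls neighbourhoods of [t] back to
    neighbourhoods of [exp (k t)]; local extrema are carried over in this way. *)
Lemma log_time_locally (Q : R -> Prop) (t : R) :
  locally t (fun s => Q (v s)) -> locally (exp (k * t)) (fun r => Q (V r)).
Proof.
  intros HQ.
  assert (Hc : filterlim (fun r => k * ln r) (locally (exp (k * t))) (locally t)).
  { assert (Hd : continuity_pt (fun r => k * ln r) (exp (k * t))).
    { apply derivable_continuous_pt. exists (k * / exp (k * t)).
      apply is_derive_Reals, (is_derive_scal ln), is_derive_ln, exp_pos. }
    apply continuity_pt_filterlim in Hd.
    now rewrite ln_exp, <- Rmult_assoc, Hk, Rmult_1_l in Hd. }
  assert (Hp : locally (exp (k * t)) (fun r => 0 < r)).
  { apply (open_gt 0), exp_pos. }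
  assert (HQv : locally (exp (k * t)) (fun r => Q (v (k * ln r)))) by exact (Hc _ HQ).
  generalize (filter_and _ _ Hp HQv). apply filter_imp.
  intros r [Hr HQr]. now rewrite log_time_eq in HQr.
Qed.

Lemma log_time_oscillation (mu1 mu2 : R) (eta eps : nat -> R) :
  (forall d, 0 < d -> Rbar_locally p_infty (fun t => mu1 - d < v t < mu2 + d)) ->
  filterlim eta eventually (Rbar_locally p_infty) ->
  filterlim eps eventually (Rbar_locally p_infty) ->
  (forall i, is_local_min v (eta i) /\ is_local_max v (eps i) /\ v (eta i) < v (eps i)) ->
  is_lim_seq (fun i => v (eta i)) mu1 -> is_lim_seq (fun i => v (eps i)) mu2 ->
  oscillates_endlessly F V (fun i => v (eta i)) (fun i => v (eps i)) /\
  LimInf F V = mu1 /\ LimSup F V = mu2.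
Proof.
  intros Hbd Heta Heps Hext Hmu1 Hmu2.
  pose proof (filterlim_comp _ _ _ _ _ _ _ _ Heta Fexp) as Heta'.
  pose proof (filterlim_comp _ _ _ _ _ _ _ _ Heps Fexp) as Heps'.
  split; [| split].
  - exists (fun i => exp (k * eta i)), (fun i => exp (k * eps i)).
    split; [exact Heta' | split; [exact Heps' |]]. intros i.
    destruct (Hext i) as [Hmin [Hmax _]].
    repeat split; try apply exp_pos.
    + now apply (log_time_locally (fun y => v (eta i) <= y)).
    + now apply (log_time_locally (fun y => y <= v (eps i))).
  - apply LimInf_eq.
    + intros d Hd. apply (log_time_eventually (fun y => mu1 - d < y)).
      generalize (Hbd d Hd). apply filter_imp. intros t Ht. lra.
    + intros P d HP Hd. apply is_lim_seq_spec in Hmu1.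
      destruct (Hmu1 (mkposreal d Hd)) as [N HN]. destruct (Heta' P HP) as [N' HN'].
      exists (exp (k * eta (N + N')%nat)). split; [apply HN'; lia |].
      specialize (HN (N + N')%nat ltac:(lia)). simpl in HN. apply Rabs_def2 in HN.
      unfold v in HN. lra.
  - apply LimSup_eq.
    + intros d Hd. apply (log_time_eventually (fun y => y < mu2 + d)).
      generalize (Hbd d Hd). apply filter_imp. intros t Ht. lra.
    + intros P d HP Hd. apply is_lim_seq_spec in Hmu2.
      destruct (Hmu2 (mkposreal d Hd)) as [N HN]. destruct (Heps' P HP) as [N' HN'].
      exists (exp (k * eps (N + N')%nat)). split; [apply HN'; lia |].
      specialize (HN (N + N')%nat ltac:(lia)). simpl in HN. apply Rabs_def2 in HN.
      unfold v in HN. lra.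
Qed.

End Logarithmic_time.

(** The nonlinear terms of the radial equation, multiplied by [r ^ (m + 2)], in the
    variables [T = ln r] and [v = r ^ m * u]. The exponential factor is [1] exactly
    for the critical exponent. *)
Lemma power_term_log_time (m l s T u : R) : 0 < u ->
  exp (m * T) * exp T ^ 2 * (Rpower (exp T) l * Rpower u s)
  = exp (m * T) * u * (exp ((2 + l - m * (s - 1)) * T) * Rpower (exp (m * T) * u) (s - 1)).
Proof.
  intros Hu. unfold Rpower. rewrite ln_mult, !ln_exp; [| apply exp_pos | easy].
  rewrite <- (exp_ln u) at 2 by easy.
  simpl. rewrite Rmult_1_r, <- !exp_plus. f_equal. ring.
Qed.

(** The Emden-Fowler change of variables. The rate [m] is chosen so that the first
    derivative drops out of the transformed equation. *)
Lemma radial_solution_orbit (n : nat) (la lb a b lam k : R) (u : R -> R) :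
  let m := (INR n - 2) / 2 in
  positive_radial_solution n la lb a b u ->
  k * k = 1 -> 1 < a -> 1 < b -> 0 < lam -> Rpower lam (a - 1) = m ^ 2 ->
  m * (a - 1) = 2 + la -> 0 < - k * (2 + lb - m * (b - 1)) ->
  perturbed_orbit a b lam (- k * (2 + lb - m * (b - 1)))
    (fun t => Rpower (exp (k * t)) m * u (exp (k * t)))
    (fun t => k * (exp (m * (k * t))
       * (m * u (exp (k * t)) + exp (k * t) * Derive u (exp (k * t))))).
Proof.
  intros m Hu Hk Ha Hb Hlam Hlam2 Hcrit Hsigma.
  assert (Hexp : forall t, Rpower (exp (k * t)) m = exp (m * (k * t)))
    by (intros t; unfold Rpower; now rewrite ln_exp).
  assert (Dexp : forall c t, is_derive (fun t => exp (c * (k * t))) t (c * k * exp (c * (k * t))))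
    by (intros c t; auto_derive; [easy | ring]).
  assert (Dr : forall t, is_derive (fun t => exp (k * t)) t (k * exp (k * t)))
    by (intros t; auto_derive; [easy | ring]).
  assert (Du : forall t, is_derive (fun t => u (exp (k * t))) t
    (k * exp (k * t) * Derive u (exp (k * t)))).
  { intros t. apply (is_derive_comp u (fun t => exp (k * t))); [| apply Dr].
    apply Derive_correct. now apply Hu, exp_pos. }
  assert (DDu : forall t, is_derive (fun t => Derive u (exp (k * t))) t
    (k * exp (k * t) * Derive (Derive u) (exp (k * t)))).
  { intros t. apply (is_derive_comp (Derive u) (fun t => exp (k * t))); [| apply Dr].
    apply Derive_correct. now apply Hu, exp_pos. }
  split; try easy.
  - intros t. apply Rmult_lt_0_compat; [apply Rpower_pos | apply Hu, exp_pos].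
  - intros t.
    apply (is_derive_ext (fun t => exp (m * (k * t)) * u (exp (k * t)))).
    { intros s. now rewrite Hexp. }
    evar_last.
    + apply (is_derive_mult (fun t => exp (m * (k * t))) (fun t => u (exp (k * t))));
        [apply Dexp | apply Du | apply Rmult_comm].
    + unfold plus, mult; simpl. ring.
  - intros t. destruct (Hu (exp (k * t)) (exp_pos _)) as [Hpos [_ [_ [_ Heq]]]].
    evar_last.
    + apply (is_derive_scal (fun t => exp (m * (k * t))
       * (m * u (exp (k * t)) + exp (k * t) * Derive u (exp (k * t))))).
      apply (is_derive_mult (fun t => exp (m * (k * t)))
        (fun t => m * u (exp (k * t)) + exp (k * t) * Derive u (exp (k * t))));
        [apply Dexp | | apply Rmult_comm].
      apply (is_derive_plus (fun t => m * u (exp (k * t)))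
        (fun t => exp (k * t) * Derive u (exp (k * t)))).
      * apply (is_derive_scal (fun t => u (exp (k * t)))), Du.
      * apply (is_derive_mult (fun t => exp (k * t)) (fun t => Derive u (exp (k * t))));
          [apply Dr | apply DDu | apply Rmult_comm].
    + unfold plus, mult; simpl. rewrite Hexp, Hlam2.
      pose proof (power_term_log_time m la a (k * t) _ Hpos) as Hpa.
      pose proof (power_term_log_time m lb b (k * t) _ Hpos) as Hpb.
      rewrite Hcrit in Hpa.
      replace ((2 + la - (2 + la)) * (k * t)) with 0 in Hpa by ring.
      rewrite exp_0, Rmult_1_l in Hpa.
      replace (- (- k * (2 + lb - m * (b - 1))) * t)
        with ((2 + lb - m * (b - 1)) * (k * t)) by ring.
      pose proof (exp_pos (k * t)) as Hr.
      set (r := exp (k * t)) in *. set (E := exp (m * (k * t))) in *.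
      assert (Heq' : Derive (Derive u) r = - ((INR n - 1) / r * Derive u r
        + Rpower r la * Rpower (u r) a + Rpower r lb * Rpower (u r) b)) by lra.
      rewrite Heq'.
      replace (INR n) with (2 * m + 2) by (unfold m; field).
      set (A := Rpower r la * Rpower (u r) a) in *.
      set (B := Rpower r lb * Rpower (u r) b) in *.
      transitivity (k * k * (E * u r * m ^ 2 - E * r ^ 2 * A - E * r ^ 2 * B));
        [field; lra | rewrite Hk, Hpa, Hpb; ring].
Qed.

Lemma positive_radial_solution_swap (n : nat) (l1 l2 p q : R) (u : R -> R) :
  positive_radial_solution n l1 l2 p q u -> positive_radial_solution n l2 l1 q p u.
Proof.
  intros Hu r Hr. destruct (Hu r Hr) as [H1 [H2 [H3 [H4 H5]]]].
  repeat split; try easy. lra.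
Qed.

(** The common form of both parts: [F] is the filter of radii that corresponds to
    large logarithmic times, and the fast decay of [v] is written with
    [k ln r] because it means [u] has a positive limit when [k = -1] and
    [r ^ (n - 2) * u] has one when [k = 1]. *)
Lemma critical_alternative (n : nat) (la lb a b lam k : R) (u : R -> R)
  (F : (R -> Prop) -> Prop) (FF : ProperFilter F) :
  let m := (INR n - 2) / 2 in
  let V := fun r => Rpower r m * u r in
  positive_radial_solution n la lb a b u ->
  k * k = 1 -> 0 < m -> 1 < a -> 1 < b -> 0 < lam -> Rpower lam (a - 1) = m ^ 2 ->
  m * (a - 1) = 2 + la -> 0 < - k * (2 + lb - m * (b - 1)) ->
  filterlim (fun t => exp (k * t)) (Rbar_locally p_infty) F ->
  filterlim (fun r => k * ln r) F (Rbar_locally p_infty) ->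
  F (fun r => 0 < r) ->
  (filterlim V F (locally lam) \/
   exists c, 0 < c /\ filterlim (fun r => exp (m * (k * ln r)) * V r) F (locally c)) \/
  exists (m1 m2 : nat -> R) (mu1 mu2 : R),
    oscillates_endlessly F V m1 m2 /\
    (forall i : nat, 0 < m1 i < m2 i) /\
    is_lim_seq m1 mu1 /\ is_lim_seq m2 mu2 /\
    LimInf F V = Finite mu1 /\ LimSup F V = Finite mu2 /\
    mu1 < mu2 /\ 0 < mu1 /\ mu1 <= lam /\ lam <= mu2 /\
    potential a lam mu1 = potential a lam mu2 /\ potential a lam mu2 < 0.
Proof.
  intros m V Hu Hk Hm Ha Hb Hlam Hlam2 Hcrit Hsigma Fexp Fln Fpos.
  pose proof (radial_solution_orbit n la lb a b lam k u Hu Hk Ha Hb Hlam Hlam2 Hcrit Hsigma)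
    as Horb.
  fold m in Horb.
  destruct (orbit_trichotomy _ _ _ _ _ _ Horb m Hm (eq_sym Hlam2)) as [H | [H | H]].
  - left. left.
    apply (filterlim_ext (fun r => 1 * V r)); [intros; apply Rmult_1_l |].
    apply (log_time_filterlim k Hk F FF Fln Fpos V (fun _ => 1)).
    eapply is_lim_ext; [| exact H]. intros t. symmetry. apply Rmult_1_l.
  - left. right. destruct H as [c [Hc Hl]]. exists c. split; [easy |].
    exact (log_time_filterlim k Hk F FF Fln Fpos V (fun t => exp (m * t)) c Hl).
  - right. destruct H as [mu1 [mu2 [eta [eps [H1 [H2 [H3 [H4 [H5 [H6 [H7 [H8 [H9 H10]]]]]]]]]]]]].
    exists (fun i => V (exp (k * eta i))), (fun i => V (exp (k * eps i))), mu1, mu2.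
    destruct (log_time_oscillation k Hk F FF Fexp Fln Fpos V mu1 mu2 eta eps)
      as [Hosc [Hinf Hsup]]; [easy.. |].
    split; [exact Hosc |]. split.
    { intros i. split; [apply (orbit_pos _ _ _ _ _ _ Horb (eta i)) | apply H8]. }
    repeat (split; [first [easy | lra] |]). easy.
Qed.

Lemma exp_opp_at_right_0 :
  filterlim (fun t => exp (-1 * t)) (Rbar_locally p_infty) (at_right 0).
Proof.
  intros P [d Hd]. exists (- ln d). intros t Ht. apply Hd; [| apply exp_pos].
  change (Rabs (exp (-1 * t) - 0) < d).
  rewrite Rminus_0_r, Rabs_right by apply Rle_ge, Rlt_le, exp_pos.
  rewrite <- (exp_ln d) by apply cond_pos. apply exp_increasing. lra.
Qed.

Lemma opp_ln_at_right_0 :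
  filterlim (fun r => -1 * ln r) (at_right 0) (Rbar_locally p_infty).
Proof.
  intros P [M HM]. exists (mkposreal _ (exp_pos (- M))). intros r Hr Hr0. apply HM.
  change (Rabs (r - 0) < exp (- M)) in Hr.
  rewrite Rminus_0_r, Rabs_right in Hr by lra.
  apply ln_increasing in Hr; [| easy]. rewrite ln_exp in Hr. lra.
Qed.

Lemma exp_at_infinity :
  filterlim (fun t => exp (1 * t)) (Rbar_locally p_infty) (Rbar_locally p_infty).
Proof.
  intros P [M HM]. exists M. intros t Ht. apply HM.
  pose proof (exp_ineq1_le (1 * t)). lra.
Qed.

Lemma ln_at_infinity :
  filterlim (fun r => 1 * ln r) (Rbar_locally p_infty) (Rbar_locally p_infty).
Proof.
  intros P [M HM]. exists (exp M). intros r Hr. apply HM.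
  rewrite <- (ln_exp M), Rmult_1_l. apply ln_increasing; [apply exp_pos | easy].
Qed.

Theorem theorem2 (n : nat) (l1 l2 p q lam1 lam2 : R) (u : R -> R)
  (hn : (3 <= n)%nat)
  (hl2 : -2 < l2) (hl21 : l2 < l1) (hl1 : l1 <= 0)
  (hp : (INR n + l1) / (INR n - 2) < p) (hpq : p < q)
  (hlam1 : 0 < lam1)
  (hlam1_eq : Rpower lam1 (p - 1) = alpha l1 p * (INR n - 2 - alpha l1 p))
  (hlam2 : 0 < lam2)
  (hlam2_eq : Rpower lam2 (q - 1) = alpha l2 q * (INR n - 2 - alpha l2 q))
  (hu : positive_radial_solution n l1 l2 p q u) :
  (q = (INR n + 2 + 2 * l2) / (INR n - 2) ->
    (filterlim (fun r => Rpower r (alpha l2 q) * u r) (at_right 0) (locally lam2) \/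
     exists c2 : R, 0 < c2 /\ filterlim u (at_right 0) (locally c2))
    \/
    exists (m1 m2 : nat -> R) (mu1 mu2 : R),
      oscillates_endlessly (at_right 0)
        (fun r => Rpower r (alpha l2 q) * u r) m1 m2 /\
      (forall i : nat, 0 < m1 i < m2 i) /\
      is_lim_seq m1 mu1 /\ is_lim_seq m2 mu2 /\
      LimInf (at_right 0) (fun r => Rpower r ((INR n - 2) / 2) * u r) = Finite mu1 /\
      LimSup (at_right 0) (fun r => Rpower r ((INR n - 2) / 2) * u r) = Finite mu2 /\
      mu1 < mu2 /\
      0 < mu1 /\ mu1 <= lam2 /\ lam2 <= mu2 /\
      potential q lam2 mu1 = potential q lam2 mu2 /\
      potential q lam2 mu2 < 0)
  /\
  (p = (INR n + 2 + 2 * l1) / (INR n - 2) ->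
    (filterlim (fun r => Rpower r (alpha l1 p) * u r)
       (Rbar_locally p_infty) (locally lam1) \/
     exists c1 : R, 0 < c1 /\
       filterlim (fun r => Rpower r (INR n - 2) * u r)
         (Rbar_locally p_infty) (locally c1))
    \/
    exists (m1 m2 : nat -> R) (mu1 mu2 : R),
      oscillates_endlessly (Rbar_locally p_infty)
        (fun r => Rpower r (alpha l1 p) * u r) m1 m2 /\
      (forall i : nat, 0 < m1 i < m2 i) /\
      is_lim_seq m1 mu1 /\ is_lim_seq m2 mu2 /\
      LimInf (Rbar_locally p_infty)
        (fun r => Rpower r ((INR n - 2) / 2) * u r) = Finite mu1 /\
      LimSup (Rbar_locally p_infty)
        (fun r => Rpower r ((INR n - 2) / 2) * u r) = Finite mu2 /\
      mu1 < mu2 /\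
      0 < mu1 /\ mu1 <= lam1 /\ lam1 <= mu2 /\
      potential p lam1 mu1 = potential p lam1 mu2).
Proof.
  assert (Hn : 3 <= INR n).
  { apply le_INR in hn. simpl in hn. lra. }
  assert (Hp1 : 1 < p).
  { apply (Rle_lt_trans _ ((INR n + l1) / (INR n - 2))); [| easy].
    apply Rle_div_r; lra. }
  set (m := (INR n - 2) / 2).
  assert (Hm : 0 < m) by (unfold m; lra).
  (* A critical exponent [s] is one with [alpha l s = m]; the power [lam ^ (s - 1)]
     is then [m ^ 2]. *)
  assert (Hcrit : forall l s, -2 < l -> s = (INR n + 2 + 2 * l) / (INR n - 2) ->
    m * (s - 1) = 2 + l /\ alpha l s = m).
  { intros l s Hl ->. unfold alpha, m. split; field; lra. }
  split.
  - intros Hq. destruct (Hcrit l2 q ltac:(lra) Hq) as [Hmq Halpha].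
    rewrite Halpha in *.
    destruct (critical_alternative n l2 l1 q p lam2 (-1) u (at_right 0) _)
      as [[H | [c [Hc H]]] | H]; fold m; try easy; try lra.
    + now apply positive_radial_solution_swap.
    + rewrite hlam2_eq. unfold m. field.
    + assert (m * (p - 1) < m * (q - 1)) by (apply Rmult_lt_compat_l; lra). lra.
    + apply exp_opp_at_right_0.
    + apply opp_ln_at_right_0.
    + exists (mkposreal 1 Rlt_0_1). now intros r _ Hr.
    + left. now left.
    + left. right. exists c. split; [easy |].
      revert H. apply filterlim_ext_loc. exists (mkposreal 1 Rlt_0_1). intros r _ Hr.
      fold m. unfold Rpower. rewrite <- Rmult_assoc, <- exp_plus.
      replace (m * (-1 * ln r) + m * ln r) with 0 by ring. rewrite exp_0. ring.
    + right. exact H.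
  - intros Hp. destruct (Hcrit l1 p ltac:(lra) Hp) as [Hmp Halpha].
    rewrite Halpha in *.
    destruct (critical_alternative n l1 l2 p q lam1 1 u (Rbar_locally p_infty) _)
      as [[H | [c [Hc H]]] | H]; fold m; try easy; try lra.
    + rewrite hlam1_eq. unfold m. field.
    + assert (m * (p - 1) < m * (q - 1)) by (apply Rmult_lt_compat_l; lra). lra.
    + apply exp_at_infinity.
    + apply ln_at_infinity.
    + now exists 0.
    + left. now left.
    + left. right. exists c. split; [easy |].
      revert H. apply filterlim_ext. intros r.
      fold m. unfold Rpower. rewrite <- Rmult_assoc, <- exp_plus.
      f_equal. f_equal. unfold m. field.
    + right. destruct H as [m1 [m2 [mu1 [mu2 H]]]].
      exists m1, m2, mu1, mu2. repeat (split; [apply H |]). apply H.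
Qed.
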